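(* There exists $\Delta_0$ such that every graph $G$ with maximum degree $\Delta \geq \Delta_0$ satisfies $$\chi_s'(G)\leq 1.93\,\Delta^2 .$$
   Context: All graphs are finite and simple. An induced (strong) matching of a graph $G$ is a set $M$ of pairwise disjoint edges such that no edge of $G$ joins endvertices of two distinct edges of $M$. The strong chromatic index $\chi_s'(G)$ is the minimum number of classes in a partition of $E(G)$ into induced matchings. Equivalently, it is the chromatic number of $L^2(G)$, the square of the line graph $L(G)$ (the square of a graph is obtained by adding an edge between any two vertices at distance $2$). *)

(* Defs.v *)
From mathcomp Require Import all_boot all_order all_algebra.
Set Implicit Arguments.
Unset Strict Implicit.
Unset Printing Implicit Defensive.

Record sgraph : Type := SGraph {
  vertex :> finType;
  adj : rel vertex;
  adj_sym : symmetric adj;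
  adj_irrefl : irreflexive adj }.

Definition max_degree (G : sgraph) : nat :=
  \max_(x : G) #|[set y | adj x y]|.

Definition edges (G : sgraph) : {set {set G}} :=
  [set [set p.1; p.2] | p : G * G & adj p.1 p.2].

Definition induced_matching (G : sgraph) (M : {set {set G}}) : bool :=
  (M \subset edges G) &&
  [forall A in M, forall B in M, (A != B) ==>
     [disjoint A & B] && [forall x in A, forall y in B, ~~ adj x y]].

Definition induced_matching_partition (G : sgraph) (P : {set {set {set G}}})
    : bool :=
  partition P (edges G) && [forall M in P, induced_matching M].

Lemma ex_induced_matching_partition (G : sgraph) :
  exists k, [exists P : {set {set {set G}}},
               induced_matching_partition P && (#|P| == k)].
Proof.
exists #|[set [set A] | A in edges G]|.
apply/existsP; exists [set [set A] | A in edges G]; rewrite eqxx andbT.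
apply/andP; split.
  apply/and3P; split.
  - apply/eqP/setP => A; rewrite cover_imset.
    apply/bigcupP/idP => [[B BE /set1P ->] //|AE].
    by exists A; rewrite ?set11.
  - apply/trivIsetP => _ _ /imsetP [A _ ->] /imsetP [B _ ->] nAB.
    rewrite disjoints1 inE; apply: contraNneq nAB => ->; exact: eqxx.
  - by apply/imsetP => -[A _ /setP /(_ A)]; rewrite !inE eqxx.
apply/forall_inP => _ /imsetP [A AE ->]; rewrite /induced_matching sub1set AE.
apply/forall_inP => B /set1P ->; apply/forall_inP => C /set1P ->.
by rewrite eqxx.
Qed.

Definition strong_chromatic_index (G : sgraph) : nat :=
  ex_minn (ex_induced_matching_partition G).

(* Main.v *)
Require Import Defs.
From HB Require Import structures.
From mathcomp Require Import all_boot all_order all_algebra.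
From mathcomp Require Import reals sequences exp.
From mathcomp Require Import ring lra zify.
Set Implicit Arguments.
Unset Strict Implicit.
Unset Printing Implicit Defensive.
Import Order.TTheory GRing.Theory Num.Theory.
Local Open Scope ring_scope.

(**
Two facts about H, the square of the line graph, give the bound; put r = 2 Delta^2.

Sparsity. If N is the set of edges within distance one of an edge uv and A is the union of the
neighbourhoods of u and v, then N consists of the edges meeting A and |A| <= 2 Delta.  Counting
the pairs of endpoints that join two edges of N, and subtracting the 4-cycles (pairs of edges
joined by a matching of two edges are counted twice), bounds the number of ordered adjacent pairs
in N by 3 Delta^4 = (3/4) r^2.

Colouring. Make H r-regular.  For each of c ~ 0.965 r colours draw independent random labels on
the vertices; the local maxima form an independent set, and each vertex takes the first colour for
which it is a local maximum.  If m neighbours of v take the same colour, v saves m - 1 colours,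
and if every vertex saves at least r - c + 1 in total, the partial colouring extends greedily.  By
Bonferroni, m - 1 >= C(m,2) - C(m,3); pairs and triples of non-adjacent neighbours become local
maxima with probabilities that can be computed exactly up to the size of the union of their
neighbourhoods, and there are few triples because the non-adjacency graph on N(v) with e edges has
at most (2e)^(3/2)/6 triangles.  The expected saving exceeds 0.036 r.  Since the labels of distinct
colours are independent, the saving (after discarding the rare colours with many local maxima in
N(v)) is concentrated by the bounded difference inequality, and the local lemma finishes the proof.
*)

(** * Averages and bounded differences *)

(** The target 1.93 Delta^2 is 0.965 r. A colour touches neither vertex of a pair with probability
    at least 1 - 2/n, where n = r + 1, so summing over the colours gives pairs a weight of about n
    (1 - exp(-1.93)) / 2; triples get at most about n/3. With a quarter of the pairs in N(v)
    nonadjacent the saving is about 0.037 r, barely above the 0.035 r that the greedy step needs,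
    and every rounded constant below spends part of this margin.

    Two obstacles shape the argument. One colour may have many local maxima in N(v), so the saving
    has no bounded differences; truncation at a constant K, fixed before r, repairs this at a cost
    controlled by third moments. The estimates also assume degree exactly r; the graph is therefore
    embedded in a regular one with 2^r times as many vertices, which is harmless because the local
    lemma does not see the number of vertices.

    Labels come from a finite set of size L, so that probability is averaging over a finite type;
    ties become negligible by choosing L large after r. *)

HB.lock Definition avg (R : realFieldType) (T : finType) (f : T -> R) : R :=
  (\sum_t f t) / #|T|%:R.
Arguments avg {R T} f.

Section Average.
Variable R : realFieldType.
Implicit Types T X Y : finType.

Lemma avgE T (f : T -> R) : avg f = (\sum_t f t) / #|T|%:R.
Proof. by rewrite avg.unlock. Qed.

Lemma eq_avg T (f g : T -> R) : f =1 g -> avg f = avg g.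
Proof. by move=> fg; rewrite !avgE; congr (_ / _); apply: eq_bigr => t _; rewrite fg. Qed.

Lemma avgD T (f g : T -> R) : avg (fun t => f t + g t) = avg f + avg g.
Proof. by rewrite !avgE big_split mulrDl. Qed.

Lemma avgN T (f : T -> R) : avg (fun t => - f t) = - avg f.
Proof. by rewrite !avgE sumrN mulNr. Qed.

Lemma avgB T (f g : T -> R) : avg (fun t => f t - g t) = avg f - avg g.
Proof. by rewrite avgD avgN. Qed.

Lemma avgZ T (c : R) (f : T -> R) : avg (fun t => c * f t) = c * avg f.
Proof. by rewrite !avgE -mulr_sumr mulrA. Qed.

Lemma avgZr T (c : R) (f : T -> R) : avg (fun t => f t * c) = avg f * c.
Proof. by rewrite [RHS]mulrC -avgZ; apply: eq_avg => t; rewrite mulrC. Qed.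

Lemma avg_sum T (J : Type) (s : seq J) (P : pred J) (F : J -> T -> R) :
  avg (fun t => \sum_(j <- s | P j) F j t) = \sum_(j <- s | P j) avg (F j).
Proof. by rewrite avgE exchange_big mulr_suml; apply: eq_bigr => j _; rewrite avgE. Qed.

Lemma ler_avg T (f g : T -> R) : (forall t, f t <= g t) -> avg f <= avg g.
Proof.
by move=> fg; rewrite !avgE ler_wpM2r ?invr_ge0 ?ler0n //; apply: ler_sum => t _.
Qed.

Lemma avg_ge0 T (f : T -> R) : (forall t, 0 <= f t) -> 0 <= avg f.
Proof. by move=> f0; rewrite avgE divr_ge0 ?ler0n ?sumr_ge0. Qed.

Lemma avg_cst T (c : R) : (0 < #|T|)%N -> avg (fun _ : T => c) = c.
Proof.
move=> T0; rewrite !avgE sumr_const -(mulr_natr c) mulfK //.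
by rewrite pnatr_eq0 -lt0n.
Qed.

Lemma avg_norm_le T (f : T -> R) (D : R) : (0 < #|T|)%N ->
  (forall t, `|f t| <= D) -> `|avg f| <= D.
Proof.
move=> T0 fD; rewrite ler_norml -(avg_cst D T0) -avgN.
by apply/andP; split; apply: ler_avg => t; have := fD t;
  rewrite ler_norml => /andP[].
Qed.

Lemma avg_pair X Y (f : X -> Y -> R) :
  avg (fun p : X * Y => f p.1 p.2) = avg (fun x => avg (f x)).
Proof.
rewrite [RHS](eq_avg (fun x => avgE (f x))) avgZr !avgE.
have <- : \sum_x \sum_y f x y = \sum_p f p.1 p.2 by rewrite pair_bigA.
by rewrite card_prod natrM invfM mulrA.
Qed.

Lemma reindex_avg T (h : T -> T) (f : T -> R) :
  involutive h -> avg (f \o h) = avg f.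
Proof.
by move=> hK; rewrite !avgE [in RHS](reindex_inj (inv_inj hK)).
Qed.

Lemma avg_prod (I X : finType) (F : I -> X -> R) :
  (0 < #|X|)%N ->
  avg (fun x : {ffun I -> X} => \prod_i F i (x i)) = \prod_i avg (F i).
Proof.
move=> X0; rewrite !avgE -[\sum_t _](bigA_distr_bigA F) card_ffun natrX.
by rewrite [RHS](eq_bigr _ (fun i _ => avgE (F i))) prodf_div prodr_const.
Qed.

End Average.

Section FfunUpdate.
Variables (I X : finType).
Implicit Types (w : {ffun I -> X}).

Definition upd w i x : {ffun I -> X} := [ffun j => if j == i then x else w j].

Lemma upd_updK w i x : upd (upd w i x) i (w i) = w.
Proof. by apply/ffunP => j; rewrite !ffunE; case: eqP => [->|]. Qed.

Lemma upd_at w i x : upd w i x i = x.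
Proof. by rewrite ffunE eqxx. Qed.

Lemma upd_upd w i x y : upd (upd w i x) i y = upd w i y.
Proof. by apply/ffunP => j; rewrite !ffunE; case: eqP. Qed.

Lemma upd_comm w i j x y : i != j -> upd (upd w i x) j y = upd (upd w j y) i x.
Proof.
move=> ij; apply/ffunP => k; rewrite !ffunE.
by case: eqP => [->|//]; rewrite eq_sym (negPf ij).
Qed.

(** Exchanging coordinate [i] with the fresh sample is an involution of the product space, so
    resampling preserves averages. *)
Lemma avg_upd (R : realFieldType) i (f : {ffun I -> X} -> R) :
  (0 < #|X|)%N -> avg (fun w => avg (fun x => f (upd w i x))) = avg f.
Proof.
move=> X0; rewrite -(avg_pair (fun w x => f (upd w i x))).
pose h (p : {ffun I -> X} * X) := (upd p.1 i p.2, p.1 i).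
have hK : involutive h by case=> w x; rewrite /h /= upd_at upd_updK.
rewrite -(reindex_avg _ hK) (eq_avg (g := fun p => f p.1)); last first.
  by case=> w x; rewrite /= upd_updK.
by rewrite (avg_pair (fun w _ => f w)); apply: eq_avg => w; rewrite avg_cst.
Qed.

End FfunUpdate.

(** * Concentration of Lipschitz functions on product spaces *)

Section BoundedDifferences.
Variable R : realType.

(** From [expR x * (1 - x) <= 1], since (1 + x + 2 x^2)(1 - x) = 1 + x^2 (1 - 2x) is at least 1 for
    x <= 1/2. *)
Lemma expR_quadratic (x : R) : x <= 2^-1 -> expR x <= 1 + x + 2 * x ^+ 2.
Proof.
move=> x2.
have y0 : 0 < 1 - x by lra.
have : expR x * (1 - x) <= 1.
  rewrite -[leRHS](expR0 R) -(subrr x) expRD.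
  by rewrite ler_pM2l ?expR_gt0 // expR_ge1Dx.
rewrite -ler_pdivlMr // => /le_trans; apply.
rewrite ler_pdivrMr //.
have -> : (1 + x + 2 * x ^+ 2) * (1 - x) = 1 + x ^+ 2 * (1 - 2 * x) by ring.
by rewrite lerDl mulr_ge0 ?sqr_ge0 //; lra.
Qed.

Lemma avg_expR_le (X : finType) (D : R) (f : X -> R) : (0 < #|X|)%N ->
  avg f = 0 -> (forall x, `|f x| <= D) -> D <= 2^-1 ->
  avg (fun x => expR (f x)) <= 1 + 2 * D ^+ 2.
Proof.
move=> X0 f0 fD D2.
apply: le_trans (_ : avg (fun x => 1 + f x + 2 * D ^+ 2) <= _).
  apply: ler_avg => x; apply: le_trans (expR_quadratic _) _.
    by apply: le_trans D2; apply: le_trans (fD x); apply: ler_norm.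
  rewrite lerD2l ler_pM2l // -[leLHS]real_normK ?num_real //.
  by rewrite lerXn2r // nnegrE // (le_trans _ (fD x)).
by rewrite !avgD !avg_cst // f0 addr0.
Qed.

Variables (I X : finType).
Hypothesis X0 : (0 < #|X|)%N.
Implicit Types (f : {ffun I -> X} -> R).

Definition lipschitz D f := forall w i x, `|f (upd w i x) - f w| <= D.

Lemma avg_ffun_gt0 : (0 < #|{ffun I -> X}|)%N.
Proof. by rewrite card_ffun expn_gt0 X0. Qed.

(** Doob's martingale, one coordinate at a time: averaging [f] over coordinate [i] gives [g], again
    Lipschitz and independent of [i]. With the other coordinates fixed, f - g is centred and bounded
    by [D], which costs one factor 1 + 2 D^2. The list [s] holds the coordinates on which [f] may
    still depend. *)
Lemma mgf_lipschitz (D : R) (s : seq I) f :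
  0 <= D -> D <= 2^-1 -> uniq s -> lipschitz D f ->
  (forall w i x, i \notin s -> f (upd w i x) = f w) ->
  avg (fun w => expR (f w - avg f)) <= (1 + 2 * D ^+ 2) ^+ size s.
Proof.
move=> D0 D2; elim: s f => [|i s IH] f /=.
  (* With no coordinate left [f] is constant: [w] is turned into [w'] along [enum I]. *)
  move=> _ _ fc; have fE w w' : f w = f w'.
    suff H (t : seq I) : f w = f [ffun j => if j \in t then w' j else w j].
      rewrite (H (enum I)); congr f; apply/ffunP => j.
      by rewrite ffunE mem_enum.
    elim: t => [|j t ->]; first by congr f; apply/ffunP => j; rewrite ffunE.
    rewrite -[LHS](fc _ j (w' j)) //; congr f; apply/ffunP => k.
    by rewrite !ffunE in_cons; case: eqP => [->|].
  have [w0 _] : exists w0 : {ffun I -> X}, w0 \in xpredT.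
    by apply/card_gt0P; apply: avg_ffun_gt0.
  rewrite (eq_avg (g := fun=> 1)) ?avg_cst ?avg_ffun_gt0 // => w.
  rewrite (eq_avg (g := fun=> f w)) ?avg_cst ?avg_ffun_gt0 ?subrr ?expR0 //.
move=> /andP[is_ us] fL fc.
pose g w := avg (fun x => f (upd w i x)).
have gE w x : g (upd w i x) = g w by apply: eq_avg => y; rewrite upd_upd.
have gL : lipschitz D g.
  move=> w j x; rewrite -avgB.
  have [->|ij] := eqVneq j i.
    rewrite (eq_avg (g := fun=> 0)) ?avg_cst ?normr0 // => y.
    by rewrite upd_upd subrr.
  by apply: avg_norm_le => // y; rewrite upd_comm // fL.
have gc w j x : j \notin s -> g (upd w j x) = g w.
  have [-> //|ij js] := eqVneq j i.
  by apply: eq_avg => y; rewrite upd_comm // fc // in_cons negb_or ij.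
have fg : avg f = avg g by rewrite -(avg_upd i).
rewrite -(avg_upd i) // exprS.
have : avg (fun w => (1 + 2 * D ^+ 2) * expR (g w - avg g)) <=
   (1 + 2 * D ^+ 2) * (1 + 2 * D ^+ 2) ^+ size s.
  by rewrite avgZ ler_pM2l ?IH // ltr_pwDl // mulr_ge0 ?sqr_ge0.
apply: le_trans; apply: ler_avg => w.
rewrite (eq_avg (g := fun x => expR (f (upd w i x) - g w) * expR (g w - avg g))).
  rewrite avgZr ler_pM2r ?expR_gt0 //; apply: avg_expR_le => //.
    by rewrite avgB avg_cst // subrr.
  move=> x.
  have -> : f (upd w i x) - g w = avg (fun y => f (upd w i x) - f (upd w i y)).
    by rewrite avgB avg_cst.
  by apply: avg_norm_le => // y; rewrite -(upd_upd w i y x) fL.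
by move=> x; rewrite -expRD fg addrA subrK.
Qed.

Lemma lower_tail_lipschitz (D eps t : R) f :
  0 < D -> 0 < eps -> eps <= 2 * D -> #|I|%:R <= t -> lipschitz D f ->
  avg (fun w => (f w <= avg f - eps * t)%R%:R) <=
  expR (- (eps ^+ 2 * t / (8 * D ^+ 2))).
Proof.
move=> D0 e0 eD It fL.
(* [l] minimizes the Chernoff exponent 2 l^2 D^2 t - l eps t, and [eps <= 2 * D] keeps l D <=
   1/2. *)
pose l := eps / (4 * D ^+ 2).
have l0 : 0 < l by rewrite divr_gt0 // mulr_gt0 // exprn_gt0.
have lD : l * D <= 2^-1.
  rewrite /l mulrAC ler_pdivrMr ?mulr_gt0 ?exprn_gt0 //.
  by rewrite [leRHS](_ : _ = (2 * D) * D); [rewrite ler_pM2r|field].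
pose g w := - l * f w.
have gL : lipschitz (l * D) g.
  move=> w i x; rewrite /g -mulrBr normrM normrN (ger0_norm (ltW l0)).
  by rewrite ler_pM2l // fL.
have gE : avg g = - l * avg f by rewrite avgZ.
have lD0 : 0 <= l * D by rewrite mulr_ge0 ?ltW.
have M := mgf_lipschitz lD0 lD (enum_uniq I) gL.
have {}M : avg (fun w => expR (g w - avg g)) <= expR (2 * l ^+ 2 * D ^+ 2 * t).
  apply: (le_trans (M _)) => [w i x|]; first by rewrite mem_enum.
  rewrite -cardE; apply: le_trans (_ : expR (2 * (l * D) ^+ 2) ^+ #|I| <= _).
    by rewrite lerXn2r ?nnegrE ?expR_ge0 ?expR_ge1Dx // addr_ge0 // mulr_ge0 // sqr_ge0.
  rewrite -expRM_natl ler_expR.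
  have -> : 2 * l ^+ 2 * D ^+ 2 * t = t * (2 * (l * D) ^+ 2) by ring.
  by rewrite ler_wpM2r // mulr_ge0 ?sqr_ge0.
apply: le_trans (_ : expR (- (l * (eps * t))) * avg (fun w => expR (g w - avg g)) <= _).
  rewrite -avgZ; apply: ler_avg => w; rewrite -expRD gE /g.
  case: (lerP (f w) (avg f - eps * t)) => H; last by rewrite expR_ge0.
  rewrite -[leLHS](expR0 R) ler_expR.
  have -> : - (l * (eps * t)) + (- l * f w - - l * avg f) =
    l * (avg f - eps * t - f w) by ring.
  by rewrite mulr_ge0 ?subr_ge0 // ltW.
apply: (le_trans (ler_wpM2l (expR_ge0 _) M)).
rewrite -expRD ler_expR le_eqVlt; apply/orP; left; apply/eqP.
by rewrite /l; field; rewrite gt_eqF.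
Qed.

End BoundedDifferences.

(** * The local lemma *)

Section LocalLemma.
Variables (R : realFieldType) (Omega V : finType).
Variables (A : V -> pred Omega) (D : V -> {set V}) (p : R) (d : nat).

Definition avoid (S : {set V}) : pred Omega := [pred w | [forall v in S, ~~ A v w]].

Arguments avoid : simpl never.
Local Notation P E := (avg (fun w : Omega => (E w)%:R : R)).

Hypothesis Omega0 : (0 < #|Omega|)%N.
Hypothesis p0 : 0 <= p.
Hypothesis pA : forall v, P (A v) <= p.
Hypothesis indep : forall v (S : {set V}), [disjoint S & D v] ->
  P (predI (A v) (avoid S)) = P (A v) * P (avoid S).
Hypothesis dD : forall v, (#|D v| <= d)%N.
Hypothesis pd : 4 * p * d%:R <= 1.
Hypothesis p4 : 4 * p <= 1.

Lemma avoid_sub (S S' : {set V}) w : S' \subset S -> avoid S w -> avoid S' w.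
Proof.
move=> /subsetP SS /forall_inP H; apply/forall_inP => v vS'.
by apply: H; apply: SS.
Qed.

Lemma avoid_ge0 (S : {set V}) : 0 <= P (avoid S).
Proof. by apply: avg_ge0 => w; rewrite ler0n. Qed.

Let le_double : p <= 2 * p.
Proof. by rewrite ler_peMl // ler1n. Qed.

(** The events of [S] outside [D v] are jointly independent of [A v]; given that they are avoided,
    those inside [D v] are avoided too with probability at least 1 - 2pd >= 1/2, by induction.
    Conditional probabilities are multiplied out, so that nothing is divided by a possibly zero
    probability. *)
Lemma lovasz_step n (S : {set V}) v : (#|S| <= n)%N ->
  P (predI (A v) (avoid S)) <= 2 * p * P (avoid S).
Proof.
elim: n S v => [|n IH] S v Sn.
  move: Sn; rewrite leqn0 cards_eq0 => /eqP ->.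
  rewrite indep; last by rewrite -setI_eq0 set0I.
  apply: ler_wpM2r; first exact: avoid_ge0.
  by apply: le_trans (pA v) le_double.
pose S1 := S :&: D v; pose S2 := S :\: D v.
have S2S : S2 \subset S by apply: subsetDl.
have dis : [disjoint S2 & D v] by rewrite -setI_eq0 setIDAC setDIl setDv setI0.
have le2 : P (predI (A v) (avoid S)) <= p * P (avoid S2).
  apply: le_trans (_ : P (predI (A v) (avoid S2)) <= _).
    apply: ler_avg => w; rewrite ler_nat /=.
    case: (A v w) => //=; case H: (avoid S w) => //.
    by rewrite (avoid_sub S2S H).
  by rewrite indep // ler_wpM2r ?avoid_ge0.
(* If [S1] is empty, [S2] is all of [S] and out of reach of the induction hypothesis, but
   independence applies directly. *)
have [S1_0|S1n0] := eqVneq S1 set0.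
  have -> : S = S2.
    by apply/esym/setDidPl; rewrite -setI_eq0 -/S1 S1_0.
  rewrite indep //; apply: ler_wpM2r; first exact: avoid_ge0.
  by apply: le_trans (pA v) le_double.
have cS2 : (#|S2| <= n)%N.
  rewrite -ltnS; apply: leq_trans Sn.
  by rewrite -(cardsID (D v) S) -[ltnLHS]add0n ltn_add2r card_gt0.
have half : P (avoid S2) <= 2 * P (avoid S).
  have U : P (avoid S2) <=
      P (avoid S) + \sum_(u in S1) P (predI (A u) (avoid S2)).
    rewrite -avg_sum -avgD; apply: ler_avg => w.
    case H2: (avoid S2 w) => /=; last first.
      by rewrite addr_ge0 ?ler0n ?sumr_ge0.
    case H: (avoid S w) => /=; first by rewrite lerDl sumr_ge0.
    have [u uS1 Au] : exists2 u, u \in S1 & A u w.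
      apply/exists_inP; apply: contraFT H; rewrite negb_exists_in => /forall_inP H1.
      apply/forall_inP => u uS; case uD: (u \in D v).
        by apply: H1; rewrite inE uS.
      by move/forall_inP: H2; apply; rewrite !inE uD.
    by rewrite add0r (bigD1 u) //= Au H2 lerDl sumr_ge0.
  have Ud : \sum_(u in S1) P (predI (A u) (avoid S2)) <= d%:R * (2 * p * P (avoid S2)).
    apply: le_trans (_ : \sum_(u in S1) 2 * p * P (avoid S2) <= _).
      by apply: ler_sum => u _; apply: IH.
    rewrite sumr_const -(mulr_natl (2 * p * P (avoid S2))) ler_wpM2r ?ler_nat //.
      by apply: mulr_ge0; [apply: mulr_ge0|exact: avoid_ge0].
    by apply: leq_trans (dD v); apply: subset_leq_card; apply: subsetIr.
  have := avoid_ge0 S2; set x := P (avoid S2) in U Ud * => x0.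
  have : d%:R * (2 * p * x) <= x / 2.
    have -> : d%:R * (2 * p * x) = 4 * p * d%:R * (x / 2) by field.
    by rewrite ler_piMl // divr_ge0.
  by move: U Ud; set y := P (avoid S); lra.
apply: le_trans le2 _; rewrite [2 * p]mulrC -mulrA; exact: ler_wpM2l.
Qed.

(** Adding the events one by one, each keeps at least the fraction 1 - 2p >= 1/2 of the probability
    of avoiding the earlier ones. *)
Lemma lovasz_local_lemma : exists w, forall v, ~~ A v w.
Proof.
suff : 0 < P (avoid setT).
  rewrite lt_neqAle => /andP[+ _] => /eqP H.
  have [|/existsPn H'] := boolP [exists w, avoid setT w].
    by case/existsP => w /forall_inP Hw; exists w => v; apply: Hw; rewrite inE.
  case: H; rewrite (eq_avg (g := fun=> 0)) ?avg_cst // => w.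
  by rewrite (negPf (H' w)).
suff H n (S : {set V}) : (#|S| <= n)%N -> 0 < P (avoid S) by apply: H (leqnn _).
elim: n S => [|n IH] S Sn.
  move: Sn; rewrite leqn0 cards_eq0 => /eqP ->.
  rewrite (eq_avg (g := fun=> 1)) ?avg_cst // => w.
  rewrite (_ : avoid _ _ = true) //; apply/forall_inP => v.
  by rewrite inE.
have [->|[v vS]] := set_0Vmem S; first by apply: IH; rewrite cards0.
have Sv : (#|S :\ v| <= n)%N by rewrite (cardsD1 v) vS add1n in Sn.
have := lovasz_step v Sv; have := IH _ Sv.
have : P (avoid (S :\ v)) <= P (avoid S) + P (predI (A v) (avoid (S :\ v))).
  rewrite -avgD; apply: ler_avg => w; rewrite -natrD ler_nat /=.
  case H: (avoid (S :\ v) w) => //=; case Av: (A v w); first by rewrite addn1.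
  rewrite (_ : avoid S w = true) //; apply/forall_inP => u uS.
  have [->|uv] := eqVneq u v; first by rewrite Av.
  by move/forall_inP: H; apply; rewrite !inE uv.
set x := P (avoid (S :\ v)); set y := P (avoid S); set z := P (predI (A v) (avoid (S :\ v))).
move=> xyz x0 zx.
have : 4 * p * x <= x by rewrite ler_piMl // ltW.
have -> : 4 * p * x = 2 * (2 * p * x) by ring.
lra.
Qed.

End LocalLemma.

(** * The local lemma for events determined by few labels *)

Section LocalEvents.
Variables (R : realFieldType) (C V T : finType).
Local Notation Omega := {ffun C -> {ffun V -> T}}.
Implicit Types (B : {set V}) (E F : pred Omega) (w : Omega).

Definition determined_on B E :=
  forall w w', (forall a y, y \in B -> w a y = w' a y) -> E w = E w'.

Lemma indep_disjoint B B' E F : determined_on B E -> determined_on B' F ->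
  [disjoint B & B'] -> (0 < #|Omega|)%N ->
  avg (fun w => (predI E F w)%:R : R) =
  avg (fun w => (E w)%:R) * avg (fun w => (F w)%:R).
Proof.
move=> EB FB dis O0.
(* Swapping the coordinates outside [B] between two independent samples is an involution; it brings
   [E] and [F], read in different samples, into a single one. *)
pose mix w w' : Omega := [ffun a => [ffun y => if y \in B then w a y else w' a y]].
pose h (p : Omega * Omega) := (mix p.1 p.2, mix p.2 p.1).
have hK : involutive h.
  by case=> w w'; congr (_, _); apply/ffunP => a; apply/ffunP => y;
    rewrite !ffunE /=; case: (y \in B).
rewrite -avgZr.
rewrite [RHS](eq_avg (g := fun w => avg (fun w' => (E w)%:R * (F w')%:R : R)));
  last by move=> w; rewrite avgZ.
rewrite -[RHS](avg_pair (fun w w' : Omega => (E w)%:R * (F w')%:R)).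
rewrite [RHS](eq_avg (g := (fun p => (predI E F p.1)%:R) \o h)).
  rewrite (reindex_avg _ hK) (avg_pair (fun w _ : Omega => (predI E F w)%:R)).
  by apply: eq_avg => w; rewrite avg_cst.
case=> w w' /=; rewrite -natrM mulnb; congr (nat_of_bool (_ && _))%:R.
  by apply: EB => a y yB; rewrite !ffunE yB.
apply: FB => a y yB'; rewrite !ffunE ifN //.
by apply: contraTN yB' => yB; rewrite (disjointFr dis).
Qed.

Lemma local_lemma_product (A : V -> pred Omega) (B : V -> {set V}) (p : R) (d : nat) :
  (0 < #|Omega|)%N -> 0 <= p -> (forall v, avg (fun w => (A v w)%:R) <= p) ->
  (forall v, determined_on (B v) (A v)) ->
  (forall v, (#|[set u | ~~ [disjoint B u & B v]]| <= d)%N) ->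
  4 * p * d%:R <= 1 -> 4 * p <= 1 -> exists w, forall v, ~~ A v w.
Proof.
move=> O0 p0 pA AB dB pd p4.
apply: (lovasz_local_lemma O0 p0 pA _ dB pd p4) => v S dis.
pose B' := \bigcup_(u in S) B u.
apply: (indep_disjoint (AB v) (B' := B')) => //.
  move=> w w' ww'; apply: eq_forallb_in => u uS; congr (~~ _).
  by apply: AB => a y yB; apply: ww'; apply/bigcupP; exists u.
apply/bigcup_disjointP => u uS; rewrite disjoint_sym.
move: dis; rewrite -setI_eq0 => /eqP/setP/(_ u); rewrite !inE uS /=.
by move/negbFE.
Qed.

End LocalEvents.

(** * Sparsity of neighbourhoods in the square of the line graph *)

Section EdgePairs.
Variables (G : sgraph) (A : {set G}).

(** The two ends of an edge are adjacent, so an edge is linked to itself and to every edge that it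
    meets: one condition covers incidence and distance one. *)
Definition linked (f g : {set G}) := [exists x in f, exists y in g, adj x y].
Definition edges_at := [set f in edges G | ~~ [disjoint f & A]].

Local Notation D := (max_degree G).

Lemma degree_le (x : G) : (#|[set y | adj x y]| <= D)%N.
Proof. exact: (leq_bigmax x). Qed.

Variable R : realFieldType.
Local Notation al x := ((x \in A)%:R : R).
(** Indicators and degrees: [n] marks the edges meeting [A], [s] is the degree in the graph they
    form, [d] the number of neighbours in [A], and [c] the number of common neighbours outside
    [A]. *)
Let e (x y : G) : R := (adj x y)%:R.
Let n x y : R := e x y * (1 - (1 - al x) * (1 - al y)).
Let s x := \sum_y n x y.
Let d x := \sum_(y in A) e x y.
Let c x y := \sum_(z | z \notin A) e x z * e z y.

Let eC x y : e x y = e y x. Proof. by rewrite /e adj_sym. Qed.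
Let e0 x y : 0 <= e x y. Proof. by rewrite ler0n. Qed.
Let nC x y : n x y = n y x. Proof. by rewrite /n eC [(1 - al x) * _]mulrC. Qed.
Let nE x y : n x y = (adj x y && ((x \in A) || (y \in A)))%:R.
Proof. by rewrite /n /e; case: adj; case: (x \in A); case: (y \in A); rewrite /= ; ring. Qed.
Let n0 x y : 0 <= n x y. Proof. by rewrite nE ler0n. Qed.
Let d0 x : 0 <= d x. Proof. by apply: sumr_ge0. Qed.

Let e_sum x : \sum_y e x y <= D%:R.
Proof.
rewrite /e -natr_sum ler_nat; apply: leq_trans (degree_le x).
rewrite -sum1_card [leqRHS]big_mkcond; apply: leq_sum => y _.
by rewrite inE; case: adj.
Qed.

Let s_in x : x \in A -> s x <= D%:R.
Proof.
move=> xA; apply: le_trans (e_sum x); apply: ler_sum => y _.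
by rewrite /n xA subrr mul0r subr0 mulr1.
Qed.

Let s_out x : x \notin A -> s x = d x.
Proof.
move=> xA; rewrite /s /d [RHS]big_mkcond; apply: eq_bigr => y _.
by rewrite nE (negPf xA) /= /e; case: adj; case: (y \in A).
Qed.

Let s0 x : 0 <= s x. Proof. by apply: sumr_ge0. Qed.

Lemma sum_edges_at_le (F : {set G} -> R) : (forall f, 0 <= F f) ->
  2 * \sum_(f in edges_at) F f <= \sum_x \sum_y n x y * F [set x; y].
Proof.
move=> F0; rewrite pair_bigA /=.
pose dart := [pred p : G * G | adj p.1 p.2 && ((p.1 \in A) || (p.2 \in A))].
rewrite [leRHS](_ : _ = \sum_(p | dart p) F [set p.1; p.2]); last first.
  rewrite [RHS]big_mkcond; apply: eq_bigr => p _; rewrite nE /=.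
  by case: ifP; rewrite ?mul1r ?mul0r.
rewrite (partition_big (fun p => [set p.1; p.2]) (mem edges_at)) /=; last first.
  case=> x y /= /andP[xy xyA]; rewrite inE; apply/andP; split.
    by apply/imsetP; exists (x, y) => //; rewrite inE.
  rewrite -setI_eq0; apply/set0Pn; case/orP: xyA => zA.
    by exists x; rewrite !inE eqxx zA.
  by exists y; rewrite !inE eqxx zA orbT.
rewrite mulr_sumr; apply: ler_sum => f; rewrite inE => /andP[/imsetP[[x y] xy fE] fA].
rewrite inE /= in xy; rewrite /= in fE.
have nxy : x != y by apply: contraTneq xy => ->; rewrite adj_irrefl.
have xyA : (x \in A) || (y \in A).
  case/pred0Pn: fA => z; rewrite /= fE !inE => /andP[/orP[/eqP->|/eqP->] ->] //.
  by rewrite orbT.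
rewrite (bigD1 (x, y)) /= ?xy ?xyA ?fE ?eqxx // (bigD1 (y, x)) /=; last first.
  by rewrite adj_sym xy orbC xyA setUC eqxx /= xpair_eqE negb_and eq_sym nxy.
rewrite [[set y; x]]setUC addrA -[leLHS]addr0 lerD ?sumr_ge0 //.
by rewrite mulr_natl mulr2n.
Qed.

(* A pair of edges joined by a matching is counted at least twice in the first four terms. *)
Let linked_le a b c' d' : (linked [set a; b] [set c'; d'])%:R <=
  e a c' + e a d' + e b c' + e b d' - e a c' * e b d' - e a d' * e b c'.
Proof.
have -> : linked [set a; b] [set c'; d'] =
  [|| adj a c', adj a d', adj b c' | adj b d'].
  apply/exists_inP/idP.
    move=> [x + /exists_inP[y]]; rewrite !inE.
    by move=> /orP[]/eqP-> /orP[]/eqP-> ->; rewrite ?orbT.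
  move=> /or4P[] H; [exists a|exists a|exists b|exists b]; rewrite ?inE ?eqxx ?orbT //;
   apply/exists_inP; [exists c'|exists d'|exists c'|exists d']; rewrite ?inE ?eqxx ?orbT //.
rewrite /e; case: (adj a c'); case: (adj a d'); case: (adj b c'); case: (adj b d') => /=; lra.
Qed.

Let sum4 (f : G -> G -> G -> G -> R) := \sum_a \sum_b \sum_c \sum_d f a b c d.

Let sum4D f g : sum4 (fun a b c d => f a b c d + g a b c d) = sum4 f + sum4 g.
Proof.
by rewrite /sum4 -big_split; do 3!(apply: eq_bigr => ? _; rewrite /= -big_split).
Qed.

Let sum4N f : sum4 (fun a b c d => - f a b c d) = - sum4 f.
Proof. by rewrite /sum4 -sumrN; do 3!(apply: eq_bigr => ? _; rewrite /= -sumrN). Qed.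

Let ler_sum4 f g : (forall a b c d, f a b c d <= g a b c d) -> sum4 f <= sum4 g.
Proof. by move=> fg; do 4!(apply: ler_sum => ? _); apply: fg. Qed.

Let swap_ab f : sum4 f = sum4 (fun a b c d => f b a c d).
Proof. exact: exchange_big. Qed.

Let swap_cd f : sum4 f = sum4 (fun a b c d => f a b d c).
Proof. by do 2!(apply: eq_bigr => ? _); apply: exchange_big. Qed.

(** Ordering the ends counts every pair of edges four times. By the symmetries a <-> b and c <-> d,
    the four linear terms of [linked_le] have the same sum [S] and the two quadratic ones the same
    sum [Q], so four times the count is at most 4 S - 2 Q. *)
Lemma card_linked_edges_at_sum :
  (#|[set p | [&& p.1 \in edges_at, p.2 \in edges_at & linked p.1 p.2]]|)%:R <=
  \sum_x \sum_y e x y * s x * s y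
  - sum4 (fun a b c d => n a b * n c d * e a c * e b d) / 2.
Proof.
set Q := sum4 _.
have -> : (#|[set p | [&& p.1 \in edges_at, p.2 \in edges_at & linked p.1 p.2]]|)%:R
    = \sum_(f in edges_at) \sum_(g in edges_at) (linked f g)%:R :> R.
  rewrite pair_big_dep /= -sum1_card natr_sum.
  rewrite [RHS]big_mkcond [LHS]big_mkcond /=; apply: eq_bigr => p _.
  by rewrite inE andbA; case: linked; rewrite ?andbT ?andbF // if_same.
have H : 4 * \sum_(f in edges_at) \sum_(g in edges_at) (linked f g)%:R <=
   sum4 (fun a b c d => n a b * n c d * (linked [set a; b] [set c; d])%:R).
  have -> : 4 = 2 * 2 :> R by ring.
  rewrite -mulrA; apply: le_trans (ler_wpM2l _ (sum_edges_at_le _)) _ => //.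
    by move=> f; apply: sumr_ge0.
  rewrite mulr_sumr; apply: ler_sum => a _; rewrite mulr_sumr; apply: ler_sum => b _.
  rewrite mulrCA.
  rewrite [leRHS](_ : _ = n a b * \sum_c \sum_d n c d * (linked [set a; b] [set c; d])%:R).
    apply: ler_wpM2l => //.
    by apply: (sum_edges_at_le (F := fun g => (linked [set a; b] g)%:R)).
  rewrite mulr_sumr; apply: eq_bigr => c' _; rewrite mulr_sumr.
  by apply: eq_bigr => d' _; rewrite mulrA.
pose S := \sum_x \sum_y e x y * s x * s y.
have SE : sum4 (fun a b c d => n a b * n c d * e a c) = S.
  apply: eq_bigr => a _; rewrite exchange_big; apply: eq_bigr => c' _ /=.
  rewrite /s -mulrA [RHS]mulrC big_distrlr mulr_suml; apply: eq_bigr => b _ /=.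
  by rewrite mulr_suml.
pose E1 a b c d := n a b * n c d * e a c.
pose Q1 a b c d := n a b * n c d * e a c * e b d.
have {}H : 4 * \sum_(f in edges_at) \sum_(g in edges_at) (linked f g)%:R <=
   4 * S - 2 * Q.
  apply: (le_trans H); apply: le_trans (_ : sum4 (fun a b c d =>
    (E1 a b c d + E1 a b d c + E1 b a c d + E1 b a d c) + - (Q1 a b c d + Q1 a b d c)) <= _).
    apply: ler_sum4 => a b c' d'.
    rewrite [leRHS](_ : _ = n a b * n c' d' * (e a c' + e a d' + e b c' + e b d' -
       e a c' * e b d' - e a d' * e b c')).
      by rewrite ler_wpM2l // mulr_ge0.
    rewrite /E1 /Q1 [n b a]nC [n d' c']nC; ring.
  have S2 : sum4 (fun a b c d => E1 a b d c) = S by rewrite -(swap_cd E1).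
  have S3 : sum4 (fun a b c d => E1 b a c d) = S by rewrite -(swap_ab E1).
  have S4 : sum4 (fun a b c d => E1 b a d c) = S.
    by rewrite -(swap_ab (fun a b c d => E1 a b d c)).
  have Q2 : sum4 (fun a b c d => Q1 a b d c) = Q by rewrite -(swap_cd Q1).
  rewrite sum4D sum4N !sum4D S2 S3 S4 Q2 -[sum4 E1]/(sum4 (fun a b c d => n a b * n c d * e a c)) SE.
  by rewrite -[sum4 Q1]/Q; lra.
by move: H; rewrite -/S; clearbody S Q; lra.
Qed.

(** Split by membership of the two ends in [A]: [s] is at most the maximum degree on [A] and equals
    [d] off [A]. The two mixed parts agree by symmetry, whence the factor 2. *)
Let sum_sE : \sum_x \sum_y e x y * s x * s y <=
  D%:R ^+ 2 * \sum_(x in A) d x + 2 * D%:R * \sum_(x | x \notin A) d x ^+ 2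
  + \sum_(x | x \notin A) \sum_(y | y \notin A) e x y * d x * d y.
Proof.
have inout : \sum_(x | x \notin A) \sum_(y in A) e x y * s x * s y <=
    D%:R * \sum_(x | x \notin A) d x ^+ 2.
  rewrite mulr_sumr; apply: ler_sum => x xA.
  apply: le_trans (_ : \sum_(y in A) e x y * (d x * D%:R) <= _).
    apply: ler_sum => y yA; rewrite -mulrA ler_wpM2l // s_out // ler_wpM2l //.
    exact: s_in.
  by rewrite -mulr_suml -/(d x) mulrA [leLHS]mulrC expr2.
rewrite (bigID (mem A)) /=.
have -> : \sum_(x in A) \sum_y e x y * s x * s y =
    \sum_(x in A) \sum_(y in A) e x y * s x * s y
    + \sum_(x | x \notin A) \sum_(y in A) e x y * s x * s y.
  rewrite [X in _ + X]exchange_big -big_split; apply: eq_bigr => x xA /=.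
  rewrite (bigID (mem A)) /=; congr (_ + _); apply: eq_bigr => y _.
  by rewrite eC mulrAC.
have -> : \sum_(x | x \notin A) \sum_y e x y * s x * s y =
    \sum_(x | x \notin A) \sum_(y in A) e x y * s x * s y
    + \sum_(x | x \notin A) \sum_(y | y \notin A) e x y * d x * d y.
  rewrite -big_split; apply: eq_bigr => x xA /=.
  rewrite (bigID (mem A)) /=; congr (_ + _); apply: eq_bigr => y yA.
  by rewrite !s_out.
have inin : \sum_(x in A) \sum_(y in A) e x y * s x * s y <=
    D%:R ^+ 2 * \sum_(x in A) d x.
  rewrite mulr_sumr; apply: ler_sum => x xA; rewrite mulr_sumr.
  apply: ler_sum => y yA; rewrite mulrAC -mulrA mulrC -mulrA.
  by rewrite expr2 -mulrA !ler_pM // ?mulr_ge0 // s_in.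
by move: inin inout; lra.
Qed.

(** The product of the degrees is at most the mean of their squares, and [x] has at most [D - d x]
    neighbours outside [A]. *)
Let sum_outE : \sum_(x | x \notin A) \sum_(y | y \notin A) e x y * d x * d y <=
  \sum_(x | x \notin A) d x ^+ 2 * (D%:R - d x).
Proof.
have H : \sum_(x | x \notin A) \sum_(y | y \notin A) e x y * d x * d y <=
  \sum_(x | x \notin A) \sum_(y | y \notin A) e x y * (d x ^+ 2 / 2)
  + \sum_(x | x \notin A) \sum_(y | y \notin A) e x y * (d y ^+ 2 / 2).
  rewrite -big_split; apply: ler_sum => x _; rewrite -big_split; apply: ler_sum => y _ /=.
  rewrite -mulrDr -mulrA ler_wpM2l //.
  by have := sqr_ge0 (d x - d y); rewrite sqrrB; lra.
apply: (le_trans H); rewrite [X in _ + X]exchange_big /= -big_split.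
apply: ler_sum => x _ /=.
rewrite [X in _ + X](eq_bigr (fun y => e x y * (d x ^+ 2 / 2))); last first.
  by move=> y _; rewrite eC.
rewrite -mulr_suml -mulrDr -splitr mulrC ler_wpM2l ?sqr_ge0 //.
by rewrite lerBrDl (le_trans _ (e_sum x)) // [leRHS](bigID (mem A)).
Qed.

(** A quadruple is a closed walk a b d c. Only walks alternating between [A] and its complement are
    kept: those with [a], [d] in [A] contribute the squared codegrees, and exchanging the ends of
    both edges gives as many with [b], [c] in [A]. *)
Let Q_ge : 2 * \sum_(a in A) \sum_(d in A) c a d ^+ 2 <=
  sum4 (fun a b c d => n a b * n c d * e a c * e b d).
Proof.
pose F a b c d := al a * al d * (1 - al b) * (1 - al c) * (e a b * e b d * (e a c * e c d)).
have FE : sum4 F = \sum_(a in A) \sum_(d in A) c a d ^+ 2.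
  rewrite [RHS]big_mkcond; apply: eq_bigr => a _ /=; rewrite /F.
  case: (boolP (a \in A)) => aA; last first.
    by do 3!(rewrite big1 // => ? _); rewrite !mul0r.
  under eq_bigr do rewrite exchange_big.
  rewrite exchange_big /= [RHS]big_mkcond; apply: eq_bigr => d' _ /=.
  case: (boolP (d' \in A)) => dA; last first.
    by do 2!(rewrite big1 // => ? _); rewrite mulr0 !mul0r.
  rewrite expr2 /c big_distrlr /= [RHS]big_mkcond; apply: eq_bigr => b _ /=.
  case: (b \in A) => /=; first by rewrite big1 // => ? _; ring.
  rewrite [RHS]big_mkcond; apply: eq_bigr => c' _ /=.
  by case: (c' \in A) => /=; ring.
rewrite -FE mulr_natl mulr2n [X in _ + X]swap_ab [X in _ + X]swap_cd -sum4D.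
apply: ler_sum4 => a b c' d'.
have P0 : 0 <= e a b * e b d' * (e a c' * e c' d') by rewrite !mulr_ge0.
move: P0; rewrite /F /n [e b a]eC [e d' c']eC.
by case: (a \in A); case: (b \in A); case: (c' \in A); case: (d' \in A);
  rewrite /=; lra.
Qed.

(** The count is at most D^2 (I + O) + D X - H, with [H] the sum of squared codegrees. Here I + O
    counts the at most 2 D^2 ordered adjacent pairs ending in [A], and D X - H sums D c - c^2 <=
    D^2/4 over at most 4 D^2 pairs. *)
Lemma card_linked_edges_at : (#|A| <= 2 * D)%N ->
  (#|[set p | [&& p.1 \in edges_at, p.2 \in edges_at & linked p.1 p.2]]|)%:R <=
  3 * D%:R ^+ 4 :> R.
Proof.
move=> cA; apply: le_trans card_linked_edges_at_sum _.
set Q := sum4 _; have := Q_ge; rewrite -/Q => HQ.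
have HS := sum_sE; have Hout := sum_outE.
have cA' : #|A|%:R <= 2 * D%:R :> R by rewrite -natrM ler_nat.
have D0 : 0 <= D%:R :> R by [].
pose X := \sum_(x | x \notin A) d x ^+ 2.
pose O := \sum_(x | x \notin A) d x.
pose I := \sum_(x in A) d x.
(* Both sides count the walks of length two with ends in [A] and middle vertex outside. *)
have Xc : X = \sum_(a in A) \sum_(b in A) c a b.
  rewrite /c; under [RHS]eq_bigr do rewrite exchange_big.
  rewrite exchange_big; apply: eq_bigr => z _ /=.
  rewrite /d expr2 big_distrlr /=; apply: eq_bigr => a _; apply: eq_bigr => b _.
  by rewrite [e z a]eC.
(* Tangent-line bounds replace Cauchy-Schwarz: both are tight when [A] and its outer neighbours
   form a [D]-regular bipartite graph of density one half. *)
have cubic : \sum_(x | x \notin A) d x ^+ 2 * (D%:R - d x) <= D%:R ^+ 2 * O - D%:R * X.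
  rewrite !mulr_sumr -sumrB; apply: ler_sum => x _.
  have := mulr_ge0 (d0 x) (sqr_ge0 (D%:R - d x)); lra.
have quad : D%:R * X - \sum_(a in A) \sum_(b in A) c a b ^+ 2 <= D%:R ^+ 4.
  rewrite Xc mulr_sumr -sumrB.
  apply: le_trans (_ : \sum_(a in A) \sum_(b in A) D%:R ^+ 2 / 4 <= _).
    apply: ler_sum => a _; rewrite mulr_sumr -sumrB; apply: ler_sum => b _.
    by have := sqr_ge0 (D%:R / 2 - c a b); lra.
  rewrite !sumr_const -mulrnA -(mulr_natl (D%:R ^+ 2 / 4)) natrM.
  have : #|A|%:R * #|A|%:R <= (2 * D%:R) * (2 * D%:R) :> R by rewrite ler_pM.
  move=> /(ler_wpM2r (_ : 0 <= D%:R ^+ 2 / 4)) H.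
  apply: le_trans (H _) _; first by rewrite divr_ge0 ?sqr_ge0.
  by rewrite le_eqVlt; apply/orP; left; apply/eqP; field.
have IO : I + O <= 2 * D%:R ^+ 2.
  have -> : I + O = \sum_x \sum_(y in A) e x y by rewrite [RHS](bigID (mem A)).
  rewrite exchange_big /=; apply: le_trans (_ : \sum_(y in A) D%:R <= _).
    by apply: ler_sum => y _; under eq_bigr do rewrite eC.
  by rewrite sumr_const -(mulr_natl D%:R) expr2 mulrA ler_wpM2r.
have : D%:R ^+ 2 * (I + O) <= D%:R ^+ 2 * (2 * D%:R ^+ 2) :> R.
  by rewrite ler_wpM2l // sqr_ge0.
move: HS Hout cubic quad HQ; rewrite -/X -/O -/I.
set S := \sum_x \sum_y _; set S2 := \sum_(x | _) \sum_(y | _) _.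
set S3 := \sum_(x | _) _ * _; set H := \sum_(a in A) _.
clearbody X O I S S2 S3 H Q; lra.
Qed.

End EdgePairs.

(** * Local maxima of random labels *)

Section PowerSums.
Local Open Scope nat_scope.

(** This and the next lemma compare the increment of x^(r+1) with its derivative at the two ends of
    [l, l+1]; telescoping them makes power sums stand in for integrals. *)
Lemma expnS_sub_ge r l : r.+1 * l ^ r + l ^ r.+1 <= l.+1 ^ r.+1.
Proof.
elim: r => [|r IH]; first by rewrite !expn0 !expn1; lia.
rewrite [l.+1 ^ _]expnS; apply: leq_trans (leq_mul (leqnn _) IH).
by rewrite ![l ^ _.+1]expnS; set a := l ^ r; nia.
Qed.

Lemma expnS_sub_le r l : l.+1 ^ r.+1 <= r.+1 * l.+1 ^ r + l ^ r.+1.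
Proof.
elim: r => [|r IH]; first by rewrite !expn0 !expn1; lia.
rewrite [l.+1 ^ r.+2]expnS; apply: (leq_trans (leq_mul (leqnn _) IH)).
have : l ^ r.+1 <= l.+1 ^ r.+1 by rewrite leq_exp2r.
rewrite ![l ^ r.+2]expnS ![l.+1 ^ r.+1]expnS.
by set a := l ^ r.+1; set b := l.+1 ^ r; nia.
Qed.

Lemma sum_expn_le r k : r.+1 * \sum_(l < k) l ^ r <= k ^ r.+1.
Proof.
elim: k => [|k IH]; first by rewrite big_ord0 muln0.
rewrite big_ord_recr mulnDr /=; apply: leq_trans (expnS_sub_ge r k).
by rewrite addnC leq_add2l.
Qed.

Lemma sum_expn_ge r k : k.-1 ^ r.+1 <= r.+1 * \sum_(l < k) l ^ r.
Proof.
elim: k => [|[|k] IH]; rewrite ?exp0n //.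
rewrite big_ord_recr mulnDr /= addnC.
by apply: leq_trans (expnS_sub_le r k) _; rewrite leq_add2l.
Qed.

Lemma sum_expS_le r k : r.+1 * \sum_(l < k) l.+1 ^ r <= k.+1 ^ r.+1.
Proof.
apply: leq_trans (sum_expn_le r k.+1); rewrite leq_mul2l /=.
by rewrite big_ord_recl leq_addl.
Qed.

(** The discrete integral of (k - x) x^m; its increments in [k] are plain power sums. *)
Lemma sum_weighted_expS_le m k :
  m.+1 * m.+2 * \sum_(l < k) (k - l) * l.+1 ^ m <= k.+2 ^ m.+2.
Proof.
elim: k => [|k IH]; first by rewrite big_ord0 muln0.
have -> : \sum_(l < k.+1) (k.+1 - l) * l.+1 ^ m =
  \sum_(l < k) (k - l) * l.+1 ^ m + \sum_(l < k.+1) l.+1 ^ m.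
  rewrite !big_ord_recr /= subSnn mul1n addnA; congr (_ + _).
  rewrite -big_split; apply: eq_bigr => l _ /=.
  by rewrite subSn 1?ltnW // mulSn addnC.
rewrite mulnDr; apply: leq_trans (expnS_sub_ge m.+1 k.+2).
rewrite addnC; apply: leq_add => //.
by rewrite mulnAC mulnC leq_mul2l sum_expS_le orbT.
Qed.

(** Discrete integral of y^d x^r over x < y < k: [x] is the smaller label, which bounds [r]
    neighbours, and [y] the larger one, which bounds the [d] remaining neighbours. Each of the two
    summations shifts [k] by one. *)
Lemma double_sum_ge r d k :
  k.-2 ^ (r + d).+2 <= r.+1 * (r + d).+2 * \sum_(j < k) j ^ d * \sum_(l < j) l ^ r.
Proof.
apply: (@leq_trans ((r + d).+2 * \sum_(j < k) j.-1 ^ (r + d).+1)).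
  case: k => [|k]; first by rewrite exp0n.
  rewrite /=; apply: leq_trans (sum_expn_ge _ _) _; rewrite leq_mul2l /=.
  by rewrite big_ord_recl /= exp0n.
rewrite mulnAC [leqLHS]mulnC leq_mul2r /= big_distrr /=; apply: leq_sum => j _.
rewrite mulnCA -addSn expnD mulnC leq_mul ?sum_expn_ge //.
by case: d => // d; rewrite leq_exp2r // leq_pred.
Qed.

Lemma inner_sum_le r d j : r.+1 * (j ^ d * \sum_(l < j.+1) l ^ r) <= j.+1 ^ (r + d).+1.
Proof.
rewrite mulnCA -addSn expnD mulnC leq_mul ?sum_expn_le //.
by case: d => // d; rewrite leq_exp2r.
Qed.

Lemma double_sum_le r d k :
  r.+1 * (r + d).+2 * \sum_(j < k) j ^ d * \sum_(l < j.+1) l ^ r <= k.+1 ^ (r + d).+2.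
Proof.
apply: leq_trans (sum_expS_le _ _); rewrite mulnAC mulnC leq_mul2l /= big_distrr /=.
by apply: leq_sum => j _; apply: inner_sum_le.
Qed.

Lemma weighted_double_sum_le r d k :
  r.+1 * (r + d).+2 * (r + d).+3 *
    \sum_(j < k) (k - j) * (j ^ d * \sum_(l < j.+1) l ^ r) <= k.+2 ^ (r + d).+3.
Proof.
apply: leq_trans (sum_weighted_expS_le _ _).
rewrite -(mulnA r.+1) mulnAC [leqLHS]mulnC leq_mul2l; apply/orP; right.
rewrite big_distrr /=; apply: leq_sum => j _.
by rewrite mulnCA leq_mul2l inner_sum_le orbT.
Qed.

End PowerSums.

(** * Probabilities that given vertices are local maxima *)

Section Labels.
Variables (R : realFieldType) (V : finType) (N : V -> {set V}) (r L : nat).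
Hypothesis NV : forall u, #|N u| = r.
Hypothesis N_irrefl : forall u, u \notin N u.
Hypothesis N_sym : forall u w, (u \in N w) = (w \in N u).
Hypothesis L0 : (0 < L)%N.

Lemma card_ord_lt (k : nat) : (k <= L)%N -> #|[pred z : 'I_L | (z < k)%N]| = k.
Proof.
move=> kL; rewrite -sum1_card -(big_ord_widen L (fun=> 1%N) kL).
by rewrite big_const_ord iter_addn mul1n addn0.
Qed.

Local Notation X := {ffun V -> 'I_L}.

(** The inequality is strict, so tied neighbours exclude each other and local maxima are independent
    for every labelling. *)
Definition local_max (x : X) u := [forall w in N u, (x w < x u)%N].

Lemma avg_all (F : V -> pred 'I_L) :
  avg (fun x : X => [forall y, F y (x y)]%:R : R) = \prod_y (#|F y|%:R / L%:R).
Proof.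
rewrite (eq_avg (g := fun x : X => \prod_y (F y (x y))%:R)); last first.
  move=> x; rewrite -natr_prod; congr (_%:R).
  have [/forallP H|/forallPn[y /negPf Fy]] := boolP [forall y, F y (x y)].
    by rewrite big1 // => y _; rewrite H.
  by rewrite (bigD1 y) //= Fy mul0n.
rewrite (avg_prod (fun y (z : 'I_L) => (F y z)%:R : R)) ?card_ord //.
apply: eq_bigr => y _; rewrite avgE card_ord -natr_sum; congr (_%:R / _).
by rewrite -sum1_card [RHS]big_mkcond; apply: eq_bigr => z _; rewrite unfold_in; case: (F y z).
Qed.

Lemma prod_pow_mem (b : R) (B : {set V}) : \prod_y b ^+ (y \in B) = b ^+ #|B|.
Proof. by rewrite prodrXr -sum1_card [in RHS]big_mkcond. Qed.

Lemma avg_local_max_at u (k : 'I_L) :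
  avg (fun x : X => ((x u == k) && local_max x u)%:R : R) =
  L%:R^-1 * (k%:R / L%:R) ^+ r.
Proof.
pose F y (z : 'I_L) :=
  if y == u then z == k else if y \in N u then (z < k)%N else true.
rewrite (eq_avg (g := fun x : X => [forall y, F y (x y)]%:R)); last first.
  move=> x; congr (nat_of_bool _)%:R; apply/andP/forallP.
    move=> [/eqP xu /forall_inP H] y; rewrite /F.
    case: eqP => [->|_]; first by rewrite /= xu.
    by case: ifP => // yN; rewrite /= -xu H.
  move=> H; have xu : x u = k by move: (H u); rewrite /F eqxx => /eqP.
  split; first exact/eqP.
  apply/forall_inP => y yN; move: (H y); rewrite /F yN.
  by case: eqP => [yu|]; rewrite /= ?xu //; rewrite yu (negPf (N_irrefl u)) in yN.
rewrite avg_all -(NV u) -[L%:R^-1]expr1 -{2}(cards1 u) -!prod_pow_mem -big_split.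
apply: eq_bigr => y _ /=; rewrite in_set1.
have [->|yu] := eqVneq y u.
  rewrite (negPf (N_irrefl u)) (@eq_card1 _ k) ?mulr1 ?mul1r //.
  by move=> z; rewrite unfold_in /F eqxx.
have [yN|yN] := boolP (y \in N u); rewrite ?mul1r ?expr1.
  have -> // : #|F y| = k.
  rewrite -[RHS](card_ord_lt (ltnW (ltn_ord k))); apply: eq_card => z.
  by rewrite unfold_in /F (negPf yu) yN.
rewrite ?mulr1 (@eq_card _ _ predT) ?card_ord ?divff ?pnatr_eq0 -?lt0n //.
by move=> z; rewrite unfold_in /F (negPf yu) (negPf yN).
Qed.

(** For l <= k a common neighbour has to stay below [l], so only [N u :\: N w] is bounded by [k].
    The set [Y] makes room for a third vertex, outside both neighbourhoods, with a condition of its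
    own. *)
Lemma avg_local_max2_at u w (Y : {set V}) (S : pred 'I_L) (l k : 'I_L) :
  u != w -> w \notin N u -> u \notin Y -> w \notin Y ->
  [disjoint Y & N u :|: N w] -> (l <= k)%N ->
  avg (fun x : X => [&& x u == k, x w == l, local_max x u, local_max x w
                      & [forall y in Y, S (x y)]]%:R : R) =
  L%:R^-1 ^+ 2 * (#|S|%:R / L%:R) ^+ #|Y| * (l%:R / L%:R) ^+ r
  * (k%:R / L%:R) ^+ #|N u :\: N w|.
Proof.
move=> uw wNu uY wY YN lk.
have uNw : u \notin N w by rewrite N_sym.
pose F y (z : 'I_L) := if y == u then z == k else if y == w then z == l else
  if y \in Y then S z else if y \in N w then (z < l)%N else
  if y \in N u then (z < k)%N else true.
have YNu y : y \in Y -> y \notin N u.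
  by move=> yY; have := disjointFr YN yY; rewrite inE => /negbT; rewrite negb_or => /andP[].
have YNw y : y \in Y -> y \notin N w.
  by move=> yY; have := disjointFr YN yY; rewrite inE => /negbT; rewrite negb_or => /andP[].
have Nu y : y \in N u -> (y != u) * (y != w) * (y \notin Y).
  move=> yN; split; last by apply: contraL yN; apply: YNu.
  by split; apply: contraTneq yN => ->.
have Nw y : y \in N w -> (y != u) * (y != w) * (y \notin Y).
  move=> yN; split; last by apply: contraL yN; apply: YNw.
  by split; apply: contraTneq yN => ->.
rewrite (eq_avg (g := fun x : X => [forall y, F y (x y)]%:R)); last first.
  move=> x; congr (nat_of_bool _)%:R; apply/and5P/forallP.
    move=> [/eqP xu /eqP xw /forall_inP Hu /forall_inP Hw /forall_inP HY] y; rewrite /F.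
    case: eqP => [->|_]; first by rewrite xu.
    case: eqP => [->|_]; first by rewrite xw.
    case: ifP => [/HY //|_]; case: ifP => [yN|_]; first by rewrite -xw Hw.
    by case: ifP => // yN; rewrite -xu Hu.
  move=> H; have xu : x u = k by move: (H u); rewrite /F eqxx => /eqP.
  have xw : x w = l by move: (H w); rewrite /F eqxx eq_sym (negPf uw) => /eqP.
  split; [exact/eqP|exact/eqP| | |].
  - apply/forall_inP => y yN; move: (H y); rewrite /F yN !(negPf (Nu y yN).1.1).
    rewrite (negPf (Nu y yN).1.2) (negPf (Nu y yN).2) xu.
    by case: ifP => // _ /leq_trans; apply.
  - apply/forall_inP => y yN; move: (H y); rewrite /F yN !(negPf (Nw y yN).1.1).
    by rewrite (negPf (Nw y yN).1.2) (negPf (Nw y yN).2) xw.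
  - apply/forall_inP => y yY; move: (H y); rewrite /F yY.
    rewrite ifN; last by apply: contraTneq yY => ->.
    by rewrite ifN //; apply: contraTneq yY => ->.
rewrite avg_all.
have <- : \prod_y (L%:R^-1 ^+ (y \in [set u]) * L%:R^-1 ^+ (y \in [set w]) *
    (#|S|%:R / L%:R) ^+ (y \in Y) * (l%:R / L%:R) ^+ (y \in N w) *
    (k%:R / L%:R) ^+ (y \in N u :\: N w)) =
  L%:R^-1 ^+ 2 * (#|S|%:R / L%:R) ^+ #|Y| * (l%:R / L%:R) ^+ r
  * (k%:R / L%:R) ^+ #|N u :\: N w| :> R.
  by rewrite !big_split !prod_pow_mem !cards1 !expr1 NV expr2.
apply: eq_bigr => y _ /=; rewrite !in_set1 in_setD.
have Lu : L%:R != 0 :> R by rewrite pnatr_eq0 -lt0n.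
have [->|yu] := eqVneq y u.
  rewrite (negPf uY) (negPf uNw) (negPf uw) (negPf (N_irrefl u)) (@eq_card1 _ k) ?mulr1 ?mul1r //.
  by move=> z; rewrite unfold_in /F eqxx.
have [->|yw] := eqVneq y w.
  rewrite (negPf wY) (negPf (N_irrefl w)) (negPf wNu) (@eq_card1 _ l) ?mulr1 ?mul1r //.
  by move=> z; rewrite unfold_in /F eqxx eq_sym (negPf uw).
have [yY|yY] := boolP (y \in Y).
  rewrite (negPf (YNu _ yY)) (negPf (YNw _ yY)) !mulr1 !mul1r expr1.
  have -> // : #|F y| = #|S|; apply: eq_card => z.
  by rewrite unfold_in /F (negPf yu) (negPf yw) yY.
have [yNw|yNw] := boolP (y \in N w).
  rewrite !mulr1 !mul1r expr1.
  have -> // : #|F y| = l.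
  rewrite -[RHS](card_ord_lt (ltnW (ltn_ord l))); apply: eq_card => z.
  by rewrite unfold_in /F (negPf yu) (negPf yw) (negPf yY) yNw.
have [yNu|yNu] := boolP (y \in N u).
  rewrite !mul1r expr1.
  have -> // : #|F y| = k.
  rewrite -[RHS](card_ord_lt (ltnW (ltn_ord k))); apply: eq_card => z.
  by rewrite unfold_in /F (negPf yu) (negPf yw) (negPf yY) (negPf yNw) yNu.
rewrite !mulr1 (@eq_card _ _ predT) ?card_ord ?divff //.
by move=> z; rewrite unfold_in /F (negPf yu) (negPf yw) (negPf yY) (negPf yNw) (negPf yNu).
Qed.

Let Lr_neq0 : L%:R != 0 :> R. Proof. by rewrite pnatr_eq0 -lt0n. Qed.
Let Lr_gt0 : 0 < L%:R :> R. Proof. by rewrite ltr0n. Qed.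

Definition prob1 : R := L%:R^-1 * \sum_(k < L) (k%:R / L%:R) ^+ r.

Lemma avg_local_max u : avg (fun x : X => (local_max x u)%:R : R) = prob1.
Proof.
rewrite /prob1 mulr_sumr -(eq_bigr _ (fun k _ => avg_local_max_at u k)) -avg_sum.
apply: eq_avg => x; rewrite (bigD1 (x u)) //= eqxx big1 ?addr0 // => k.
by rewrite eq_sym => /negPf ->.
Qed.

Let prob1E : prob1 = (\sum_(k < L) k ^ r)%:R / L%:R ^+ r.+1.
Proof.
rewrite /prob1 exprS invfM [RHS]mulrCA; congr (_ * _).
by rewrite natr_sum mulr_suml; apply: eq_bigr => k _; rewrite exprMn exprVn natrX.
Qed.

Lemma prob1_le : prob1 <= r.+1%:R^-1.
Proof.
rewrite prob1E ler_pdivrMr ?exprn_gt0 // mulrC ler_pdivlMr // mulrC.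
by rewrite -natrM -natrX ler_nat sum_expn_le.
Qed.

Lemma prob1_ge : (L.-1%:R / L%:R) ^+ r.+1 / r.+1%:R <= prob1.
Proof.
rewrite prob1E ler_pdivrMr // exprMn exprVn mulrAC ler_pM2r ?invr_gt0 ?exprn_gt0 //.
by rewrite -natrM -natrX ler_nat mulnC sum_expn_ge.
Qed.

(* The size of the union of the closed neighbourhoods of nonadjacent [u] and [w]. *)
Definition union_size u w := (r + #|N u :\: N w|).+2.

Lemma union_sizeC u w : union_size u w = union_size w u.
Proof.
rewrite /union_size; congr (_ + _).+2; apply/eqP.
by rewrite -(eqn_add2l #|N u :&: N w|) cardsID setIC cardsID !NV.
Qed.

Let event u w (Y : {set V}) (S : pred 'I_L) (k l : 'I_L) : R :=
  avg (fun x : X => [&& x u == k, x w == l, local_max x u, local_max x w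
                      & [forall y in Y, S (x y)]]%:R : R).

Let eventE u w (Y : {set V}) (S : pred 'I_L) (k l : 'I_L) :
  u != w -> w \notin N u -> u \notin Y -> w \notin Y ->
  [disjoint Y & N u :|: N w] -> (l <= k)%N ->
  event u w Y S k l = (#|S|%:R / L%:R) ^+ #|Y| * (k ^ #|N u :\: N w| * l ^ r)%:R
     / L%:R ^+ union_size u w.
Proof.
move=> uw wN uY wY dis lk; rewrite /event avg_local_max2_at //.
rewrite /union_size !exprS exprD natrM !natrX !exprMn !exprVn !invfM expr0 invr1.
ring.
Qed.

Let eventC u w Y S k l : event u w Y S k l = event w u Y S l k.
Proof.
apply: eq_avg => x; congr (nat_of_bool _)%:R.
by case: eqP; case: eqP; case: (local_max x u); case: (local_max x w).
Qed.

Let local_max2_sum x u w : (local_max x u && local_max x w)%:R =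
  \sum_k \sum_l [&& x u == k, x w == l, local_max x u, local_max x w
                      & [forall y in set0, xpredT (x y)]]%:R :> R.
Proof.
rewrite (bigD1 (x u)) //= (bigD1 (x w)) //= !eqxx /=.
rewrite (_ : [forall y in set0, true] = true); last first.
  by apply/forall_inP => y; rewrite inE.
rewrite andbT [X in _ + X]big1 ?addr0; last first.
  by move=> k; rewrite eq_sym => /negPf ->; rewrite big1.
by rewrite [X in _ + X]big1 ?addr0 // => l; rewrite eq_sym => /negPf ->.
Qed.

Let sum_below (F : nat -> nat -> nat) :
  \sum_(k < L) \sum_(l < L | (l < k)%N) (F k l)%:R = (\sum_(k < L) \sum_(l < k) F k l)%:R :> R.
Proof.
rewrite natr_sum; apply: eq_bigr => k _; rewrite natr_sum.
by rewrite (big_ord_widen L (fun l => (F k l)%:R : R)) // ltnW.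
Qed.

Let sum_upto (F : nat -> nat -> nat) :
  \sum_(k < L) \sum_(l < L | (l <= k)%N) (F k l)%:R = (\sum_(k < L) \sum_(l < k.+1) F k l)%:R :> R.
Proof.
rewrite natr_sum; apply: eq_bigr => k _; rewrite natr_sum.
by rewrite (big_ord_widen L (fun l => (F k l)%:R : R)).
Qed.

Let double (z : R) : 2 * z = z + z. Proof. by rewrite mulr_natl mulr2n. Qed.

(** Either order of the two labels contributes 1/((r+1) M), with [M] the union size; ties are
    dropped. The ratio (L - 2)/L pays for the two shifts in the power sums. *)
Lemma avg_local_max2_ge u w : u != w -> w \notin N u ->
  (L.-2%:R / L%:R) ^+ union_size u w * (2 / (r.+1%:R * (union_size u w)%:R)) <=
  avg (fun x : X => (local_max x u && local_max x w)%:R : R).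
Proof.
have half a b : a != b -> b \notin N a ->
    (L.-2%:R / L%:R) ^+ union_size a b / (r.+1%:R * (union_size a b)%:R) <=
    \sum_(k < L) \sum_(l < L | (l < k)%N) event a b set0 xpredT k l.
  move=> ab bN.
  rewrite (eq_bigr (fun k : 'I_L => \sum_(l < L | (l < k)%N)
     (k ^ #|N a :\: N b| * l ^ r)%:R / L%:R ^+ union_size a b)); last first.
    move=> k _; apply: eq_bigr => l lk; rewrite eventE ?inE ?cards0 ?expr0 ?mul1r ?(ltnW lk) //.
    by rewrite -setI_eq0 set0I.
  under eq_bigr do rewrite -mulr_suml.
  rewrite -mulr_suml (sum_below (fun k l => k ^ #|N a :\: N b| * l ^ r)%N).
  rewrite exprMn exprVn mulrAC ler_pM2r ?invr_gt0 ?exprn_gt0 //.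
  rewrite ler_pdivrMr ?mulr_gt0 ?ltr0n // -!natrM -natrX ler_nat mulnC.
  under eq_bigr do rewrite -big_distrr.
  exact: double_sum_ge.
move=> uw wN.
have := half u w uw wN; have := half w u; rewrite eq_sym N_sym => /(_ uw wN).
rewrite -union_sizeC => H1 H2.
rewrite (eq_avg (local_max2_sum ^~ u ^~ w)) avg_sum.
under eq_bigr do rewrite avg_sum.
apply: le_trans (_ : \sum_(k < L) \sum_(l < L | (l < k)%N) event u w set0 xpredT k l
  + \sum_(k < L) \sum_(l < L | (k < l)%N) event u w set0 xpredT k l <= _).
  rewrite [X in _ + X](_ : _ = \sum_(k < L) \sum_(l < L | (l < k)%N) event w u set0 xpredT k l).
    apply: le_trans (lerD H2 H1); rewrite le_eqVlt; apply/orP; left; apply/eqP.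
    by rewrite mulrCA double.
  rewrite (exchange_big_dep xpredT) //=; apply: eq_bigr => k _.
  by apply: eq_bigr => l _; rewrite eventC.
rewrite -big_split; apply: ler_sum => k _ /=.
rewrite [leRHS](bigID (fun l : 'I_L => (l < k)%N)) /= lerD2l.
rewrite big_mkcond [leRHS]big_mkcond; apply: ler_sum => l _.
have E0 : 0 <= event u w set0 xpredT k l by apply: avg_ge0 => x; rewrite ler0n.
by case: ltngtP.
Qed.

(** Ties fall into both sums, which is harmless in an upper bound. Of the two conditions on [Y],
    only the one for the larger label is kept. *)
Let avg_local_max2_bound u w (Y : {set V}) (S : 'I_L -> pred 'I_L) :
  avg (fun x : X => [&& local_max x u, local_max x w
    & [forall y in Y, S (x u) (x y) && S (x w) (x y)]]%:R : R) <=
  \sum_(k < L) \sum_(l < L | (l <= k)%N) event u w Y (S k) k l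
  + \sum_(k < L) \sum_(l < L | (l <= k)%N) event w u Y (S k) k l.
Proof.
under [X in _ <= X + _]eq_bigr do rewrite -avg_sum.
under [X in _ <= _ + X]eq_bigr do rewrite -avg_sum.
rewrite -!avg_sum -avgD; apply: ler_avg => x.
case: (boolP [&& _, _ & _]) => [|_]; last first.
  by rewrite addr_ge0 // sumr_ge0 // => k _; rewrite sumr_ge0.
move=> /and3P[lu lw /forall_inP SY].
have [wu|uw] := leqP (x w) (x u).
  rewrite (bigD1 (x u)) //= (bigD1 (x w)) //= !eqxx lu lw /=.
  rewrite (_ : [forall y in Y, _] = true); last first.
    by apply/forall_inP => y /SY /andP[].
  by rewrite -!addrA lerDl !addr_ge0 // sumr_ge0 // => k _; rewrite sumr_ge0.
have {}uw := ltnW uw; rewrite addrC (bigD1 (x w)) //= (bigD1 (x u)) //= !eqxx lu lw /=.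
rewrite (_ : [forall y in Y, _] = true); last first.
  by apply/forall_inP => y /SY /andP[].
by rewrite -!addrA lerDl !addr_ge0 // sumr_ge0 // => k _; rewrite sumr_ge0.
Qed.

Lemma avg_local_max2_le u w : u != w -> w \notin N u ->
  avg (fun x : X => (local_max x u && local_max x w)%:R : R) <=
  (L.+1%:R / L%:R) ^+ union_size u w * (2 / (r.+1%:R * (union_size u w)%:R)).
Proof.
have half a b : a != b -> b \notin N a ->
    \sum_(k < L) \sum_(l < L | (l <= k)%N) event a b set0 xpredT k l <=
    (L.+1%:R / L%:R) ^+ union_size a b / (r.+1%:R * (union_size a b)%:R).
  move=> ab bN.
  rewrite (eq_bigr (fun k : 'I_L => \sum_(l < L | (l <= k)%N)
     (k ^ #|N a :\: N b| * l ^ r)%:R / L%:R ^+ union_size a b)); last first.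
    move=> k _; apply: eq_bigr => l lk; rewrite eventE ?inE ?cards0 ?expr0 ?mul1r //.
    by rewrite -setI_eq0 set0I.
  under eq_bigr do rewrite -mulr_suml.
  rewrite -mulr_suml (sum_upto (fun k l => k ^ #|N a :\: N b| * l ^ r)%N).
  rewrite exprMn exprVn [leRHS]mulrAC ler_pM2r ?invr_gt0 ?exprn_gt0 //.
  rewrite ler_pdivlMr ?mulr_gt0 ?ltr0n // -!natrM -natrX ler_nat mulnC.
  under eq_bigr do rewrite -big_distrr.
  exact: double_sum_le.
move=> uw wN.
have := half u w uw wN; have := half w u; rewrite eq_sym N_sym => /(_ uw wN).
rewrite -union_sizeC => H1 H2.
rewrite (eq_avg (g := fun x : X => [&& local_max x u, local_max x w
    & [forall y in (set0 : {set V}), true && true]]%:R : R)); last first.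
  move=> x; rewrite (_ : [forall y in set0, _] = true) ?andbT //.
  by apply/forall_inP => y; rewrite inE.
apply: le_trans (avg_local_max2_bound u w set0 (fun=> xpredT)) _.
apply: le_trans (lerD H2 H1) _; rewrite le_eqVlt; apply/orP; left; apply/eqP.
by rewrite [RHS]mulrCA double.
Qed.

Let card_ge (k : 'I_L) : #|[pred z : 'I_L | (k <= z)%N]| = (L - k)%N.
Proof.
rewrite (@eq_card _ _ (predC [pred z : 'I_L | (z < k)%N])); last first.
  by move=> z; rewrite !inE leqNgt.
have kL := ltnW (ltn_ord k).
have := cardC [pred z : 'I_L | (z < k)%N]; rewrite (card_ord_lt kL) card_ord => H.
by apply/eqP; rewrite -(eqn_add2l k) H subnKC.
Qed.

(** Meant for triples of local maxima in which [a] has the largest label: that [a] beats its own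
    neighbours is forgotten. Its L - k possible labels turn the double integral into a triple one,
    whence the extra denominator M + 1. *)
Lemma avg_max_local_max2_le u w a : u != w -> w \notin N u ->
  u != a -> w != a -> a \notin N u -> a \notin N w ->
  avg (fun x : X => [&& local_max x u, local_max x w, (x u <= x a)%N & (x w <= x a)%N]%:R : R) <=
  (L.+2%:R / L%:R) ^+ (union_size u w).+1
    * (2 / (r.+1%:R * (union_size u w)%:R * (union_size u w).+1%:R)).
Proof.
pose S (k : 'I_L) : pred 'I_L := [pred z : 'I_L | (k <= z)%N].
have half b c : b != c -> c \notin N b -> b != a -> c != a ->
    a \notin N b -> a \notin N c ->
    \sum_(k < L) \sum_(l < L | (l <= k)%N) event b c [set a] (S k) k l <=
    (L.+2%:R / L%:R) ^+ (union_size b c).+1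
    / (r.+1%:R * (union_size b c)%:R * (union_size b c).+1%:R).
  move=> bc cN ba ca aNb aNc.
  rewrite (eq_bigr (fun k : 'I_L => \sum_(l < L | (l <= k)%N)
     ((L - k) * (k ^ #|N b :\: N c| * l ^ r))%:R / L%:R ^+ (union_size b c).+1)); last first.
    move=> k _; apply: eq_bigr => l lk; rewrite eventE ?in_set1 //.
      rewrite cards1 expr1 (_ : #|S k| = (L - k)%N); last exact: card_ge.
      by rewrite (exprS _ (union_size b c)) [in RHS]invfM [in RHS]natrM [RHS]mulrACA mulrA.
    by rewrite disjoints1 !inE negb_or aNb.
  under eq_bigr do rewrite -mulr_suml.
  rewrite -mulr_suml (sum_upto (fun k l => (L - k) * (k ^ #|N b :\: N c| * l ^ r))%N).
  rewrite exprMn exprVn [leRHS]mulrAC ler_pM2r ?invr_gt0 ?exprn_gt0 //.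
  rewrite ler_pdivlMr ?mulr_gt0 ?ltr0n // -!natrM -natrX ler_nat mulnC.
  under eq_bigr do (rewrite -big_distrr /= -big_distrr).
  exact: weighted_double_sum_le.
move=> uw wN ua wa aNu aNw.
have := half u w uw wN ua wa aNu aNw; have := half w u.
rewrite eq_sym N_sym => /(_ uw wN wa ua aNw aNu).
rewrite -union_sizeC => H1 H2.
rewrite (eq_avg (g := fun x : X => [&& local_max x u, local_max x w
    & [forall y in [set a], S (x u) (x y) && S (x w) (x y)]]%:R : R)); last first.
  move=> x; congr (nat_of_bool _)%:R; congr (_ && _); congr (_ && _).
  apply/idP/forall_inP => [H y|]; first by rewrite in_set1 => /eqP ->.
  by apply; rewrite in_set1.
apply: le_trans (avg_local_max2_bound u w [set a] S) _.
apply: le_trans (lerD H2 H1) _; rewrite le_eqVlt; apply/orP; left; apply/eqP.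
by rewrite [RHS]mulrCA double.
Qed.

End Labels.

(** * The expected saving of a random partial colouring *)

Section Fresh.
Variables (V : finType) (c : nat).
Implicit Types (F : 'I_c -> {set V}) (D : {set V}).

Definition fresh F (a : 'I_c) : {set V} := F a :\: \bigcup_(b < c | (b < a)%N) F b.

Lemma fresh_inj F u a b : u \in fresh F a -> u \in fresh F b -> a = b.
Proof.
rewrite !inE => /andP[na ua] /andP[nb ub]; apply: val_inj.
case: (ltngtP a b) => // ab.
  by case/bigcupP: nb; exists a.
by case/bigcupP: na; exists b.
Qed.

Lemma ex_fresh F u a : u \in F a -> exists b : 'I_c, u \in fresh F b.
Proof.
move=> ua; case: (arg_minnP (fun b : 'I_c => val b) (P := fun b => u \in F b) ua).
move=> b ub bmin; exists b; rewrite inE ub andbT.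
by apply/bigcupP => -[b' b'b ub']; have := bmin _ ub'; rewrite leqNgt b'b.
Qed.

Lemma sum_card_freshI F D : (\sum_a #|fresh F a :&: D| <= #|D|)%N.
Proof.
under eq_bigr do rewrite -sum1_card big_mkcond.
rewrite exchange_big /= -sum1_card [leqRHS]big_mkcond; apply: leq_sum => u _.
have [a ua|nu] := pickP (fun a : 'I_c => u \in fresh F a :&: D).
  rewrite (bigD1 a) //= ua big1 ?addn0; first by move: ua; rewrite inE => /andP[_ ->].
  move=> b ba; case: ifP => // ub; case/eqP: ba.
  by apply: (@fresh_inj F u); [move: ub | move: ua]; rewrite inE => /andP[].
by rewrite big1 // => a _; rewrite nu.
Qed.

Lemma sum_card_fresh F : (\sum_a #|fresh F a| = #|\bigcup_a F a|)%N.
Proof.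
apply/eqP; rewrite eqn_leq; apply/andP; split.
  apply: leq_trans (sum_card_freshI F _); apply: leq_sum => a _.
  rewrite (setIidPl _) //; apply: subset_trans (subsetDl _ _) _.
  exact: bigcup_sup.
under [leqRHS]eq_bigr do rewrite -sum1_card big_mkcond.
rewrite exchange_big /= -sum1_card big_mkcond; apply: leq_sum => u _.
case: ifP => // /bigcupP[a _ /ex_fresh[b ub]].
by rewrite (bigD1 b) //= ub.
Qed.

Definition saving F := (\sum_a #|fresh F a|.-1)%N.

Lemma savingE F : (saving F + \sum_a (fresh F a != set0) = #|\bigcup_a F a|)%N.
Proof.
rewrite /saving -big_split -sum_card_fresh; apply: eq_bigr => a _ /=.
by rewrite -card_gt0; case: #|_| => // n; rewrite addn1.
Qed.

(** Emptying classes cannot enlarge the coloured set, and a colour outside [B] that was in use stays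
    in use because its fresh vertices remain fresh. *)
Lemma saving_restrict F F' (B : pred 'I_c) : (forall a, F' a = if B a then set0 else F a) ->
  (saving F' <= saving F + \sum_a B a)%N.
Proof.
move=> F'E; have := savingE F; have := savingE F'.
have FF a : F' a \subset F a by rewrite F'E; case: ifP => // _; apply: sub0set.
have : (#|\bigcup_a F' a| <= #|\bigcup_a F a|)%N.
  apply: subset_leq_card; apply/bigcupsP => a _; apply: subset_trans (FF a) _.
  exact: bigcup_sup.
have : (\sum_a (fresh F a != set0) <= \sum_a (fresh F' a != set0) + \sum_a B a)%N.
  rewrite -big_split; apply: leq_sum => a _ /=.
  case Ba: (B a); first by rewrite addn1; case: (_ != _).
  rewrite addn0; case: (set_0Vmem (fresh F a)) => [->|[u]]; first by rewrite eqxx.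
  rewrite inE => /andP[nu ua]; rewrite (_ : fresh F' a != set0) ?leq_b1 //.
  apply/set0Pn; exists u; rewrite inE F'E Ba ua andbT.
  apply: contra nu => /bigcupP[b ba ub]; apply/bigcupP; exists b => //.
  exact: (subsetP (FF b)).
lia.
Qed.

(** Outside [F a :|: F' a] all first colours agree, and the vertices of that set affect either
    saving by at most their number. *)
Lemma saving_change F F' a : (forall b, b != a -> F b = F' b) ->
  (saving F <= saving F' + 2 * (#|F a| + #|F' a|))%N.
Proof.
move=> FF; pose D := F a :|: F' a.
have DE : (#|D| <= #|F a| + #|F' a|)%N by rewrite cardsU leq_subr.
have same b : fresh F b :\: D = fresh F' b :\: D.
  apply/setP => u; rewrite !inE negb_or.
  case: (boolP (u \in F a)) => //= ua; case: (boolP (u \in F' a)) => //= ua'.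
  congr (~~ _ && _); last first.
    by have [->|/FF -> //] := eqVneq b a; rewrite (negPf ua) (negPf ua').
  apply/bigcupP/bigcupP => -[b' b'b ub']; exists b' => //; move: ub'.
    by have [->|/FF -> //] := eqVneq b' a; rewrite (negPf ua).
  by have [->|/FF -> //] := eqVneq b' a; rewrite (negPf ua').
have : (saving F <= saving F' + \sum_b #|fresh F b :&: D| + \sum_b #|fresh F' b :&: D|)%N.
  rewrite /saving -!big_split; apply: leq_sum => b _ /=.
  by rewrite -(cardsID D (fresh F b)) -(cardsID D (fresh F' b)) same; lia.
have := sum_card_freshI F D; have := sum_card_freshI F' D; lia.
Qed.

End Fresh.

(** * Discarding colours with many candidates *)

Section Truncation.
Variables (R : realFieldType) (X V : finType) (c K : nat) (W : X -> {set V}).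
Local Notation Omega := {ffun 'I_c -> X}.
Implicit Types (w : Omega).

Definition trunc (x : X) : {set V} := if (#|W x| <= K)%N then W x else set0.

Lemma trunc_sub x : trunc x \subset W x.
Proof. by rewrite /trunc; case: ifP => // _; apply: sub0set. Qed.

Lemma card_trunc x : (#|trunc x| <= K)%N.
Proof. by rewrite /trunc; case: ifP => //; rewrite cards0. Qed.

(* Ignoring a colour with more than [K] candidates costs at most one saved colour, and makes the
   saving a Lipschitz function of the labels. *)
Definition truncated_saving w : R :=
  (saving (fun a => trunc (w a)))%:R - (\sum_a (K < #|W (w a)|)%N)%:R.

Lemma truncated_saving_le w : truncated_saving w <= (saving (fun a => W (w a)))%:R.
Proof.
rewrite /truncated_saving lerBlDr -natrD ler_nat.
by apply: saving_restrict => a; rewrite /trunc ltnNge; case: leqP.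
Qed.

(** The constant is 2 (K + K) for replacing one truncated class, plus 1 for the count of discarded
    colours. *)
Lemma truncated_saving_change w a x :
  truncated_saving (upd w a x) <= truncated_saving w + (4 * K + 1)%:R.
Proof.
have H1 : (saving (fun b => trunc (upd w a x b)) <=
           saving (fun b => trunc (w b)) + 4 * K)%N.
  apply: leq_trans (@saving_change _ _ _ (fun b => trunc (w b)) a _) _.
    by move=> b /negPf ba; rewrite ffunE ba.
  have := card_trunc (upd w a x a); have := card_trunc (w a); lia.
have H2 : (\sum_b (K < #|W (w b)|)%N <= \sum_b (K < #|W (upd w a x b)|)%N + 1)%N.
  have E : (\sum_(b | b != a) (K < #|W (w b)|) = \sum_(b | b != a) (K < #|W (upd w a x b)|))%N.
    by apply: eq_bigr => b /negPf ba; rewrite ffunE ba.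
  rewrite (bigD1 a) //= [X in (_ <= X + _)%N](bigD1 a) //= E.
  by apply: leq_trans (leq_add (leq_b1 _) (leqnn _)) _; rewrite addnC leq_add2r leq_addl.
rewrite /truncated_saving.
move: H1 H2; rewrite -(ler_nat R) -[(_ <= _ + 1)%N](ler_nat R) !natrD; lra.
Qed.

Lemma lipschitz_truncated_saving : forall w a x,
  `|truncated_saving (upd w a x) - truncated_saving w| <= (4 * K + 1)%:R.
Proof.
move=> w a x; have := truncated_saving_change w a x.
have := truncated_saving_change (upd w a x) a (w a); rewrite upd_updK => H1 H2.
by rewrite ler_norml; apply/andP; split; lra.
Qed.

End Truncation.

(** * Factorial moments and Bonferroni's inequality *)

Section Moments.
Variables (R : realFieldType) (V : finType).
Implicit Types (A : {set V}).

Definition mom2 A : R := #|A|%:R * (#|A|%:R - 1).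
Definition mom3 A : R := #|A|%:R * (#|A|%:R - 1) * (#|A|%:R - 2).

Lemma card_setD1_sum A u : (\sum_w ((w != u) && (w \in A)) = #|A :\ u|)%N.
Proof.
by rewrite -sum1_card [RHS]big_mkcond; apply: eq_bigr => w _; rewrite !inE; case: (_ && _).
Qed.

Lemma mom2E A :
  mom2 A = \sum_u \sum_w ((u != w) && ([set u; w] \subset A))%:R.
Proof.
have E u : \sum_w ((u != w) && ([set u; w] \subset A))%:R =
    (u \in A)%:R * (#|A|%:R - 1) :> R.
  rewrite -natr_sum; have [uA|uA] := boolP (u \in A); last first.
    rewrite mul0r big1 // => w _.
    by rewrite subUset sub1set (negPf uA) andbF.
  rewrite mul1r (cardsD1 u A) uA natrD addrAC subrr add0r -card_setD1_sum.
  by congr (_%:R); apply: eq_bigr => w _; rewrite eq_sym subUset !sub1set uA.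
under eq_bigr do rewrite E.
rewrite -mulr_suml -natr_sum; congr (_%:R * _).
by rewrite -sum1_card [LHS]big_mkcond; apply: eq_bigr => u _; case: (u \in A).
Qed.

Lemma mom3_at A u :
  \sum_w \sum_z [&& u != w, u != z, w != z & [set u; w; z] \subset A]%:R =
  (u \in A)%:R * ((#|A|%:R - 1) * (#|A|%:R - 2)) :> R.
Proof.
have [uA|uA] := boolP (u \in A); last first.
  rewrite mul0r big1 // => w _; rewrite big1 // => z _.
  by rewrite !subUset sub1set (negPf uA) !andbF.
rewrite mul1r (cardsD1 u A) uA natrD.
have -> : (1 + #|A :\ u|%:R - 1) * (1 + #|A :\ u|%:R - 2) = mom2 (A :\ u).
  by rewrite /mom2; ring.
rewrite mom2E; apply: eq_bigr => w _; apply: eq_bigr => z _.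
congr (nat_of_bool _)%:R; rewrite !subUset !sub1set uA !inE ![u == _]eq_sym.
by case: (w == u); case: (z == u); case: (w == z); case: (w \in A); case: (z \in A).
Qed.

Lemma mom3E A : mom3 A =
  \sum_u \sum_w \sum_z [&& u != w, u != z, w != z & [set u; w; z] \subset A]%:R.
Proof.
under eq_bigr do rewrite mom3_at.
rewrite -mulr_suml -natr_sum /mom3 -mulrA; congr (_%:R * _).
by rewrite -sum1_card [LHS]big_mkcond; apply: eq_bigr => u _; case: (u \in A).
Qed.

(** For m = |A| >= 1 the difference of the two sides is C(m-1, 3); the empty set is special because
    the predecessor is truncated. *)
Lemma bonferroni A : mom2 A / 2 - mom3 A / 6 <= #|A|.-1%:R.
Proof.
rewrite /mom2 /mom3; case: #|A| => [|[|[|n]]] /=; rewrite ?mul0r ?subr0 //; try lra.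
have n0 : 0 <= n%:R :> R by [].
rewrite -[n.+3]addn3 -[n.+2]addn2 !natrD -subr_ge0.
have -> : n%:R + 2 - ((n%:R + 3) * (n%:R + 3 - 1) / 2 -
   (n%:R + 3) * (n%:R + 3 - 1) * (n%:R + 3 - 2) / 6) =
  (n%:R + 2) * (n%:R + 1) * n%:R / 6 :> R by field.
by rewrite divr_ge0 // !mulr_ge0 // addr_ge0.
Qed.

Lemma mom2_ge0 A : 0 <= mom2 A.
Proof. by rewrite mom2E; do 2!(apply: sumr_ge0 => ? _). Qed.

Lemma mom3_ge0 A : 0 <= mom3 A.
Proof. by rewrite mom3E; do 3!(apply: sumr_ge0 => ? _). Qed.

End Moments.

Lemma geometric_sum_le (R : realFieldType) (c : nat) (q y : R) :
  0 < y -> 0 <= q <= 1 - y -> \sum_(a < c) q ^+ a <= y^-1.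
Proof.
move=> y0 /andP[q0 q1]; rewrite -[leRHS]mul1r ler_pdivlMr //.
have : (1 - q) * \sum_(a < c) q ^+ a = 1 - q ^+ c.
  by rewrite -[1 - q]opprB mulNr -subrX1 opprB.
have S0 : 0 <= \sum_(a < c) q ^+ a by rewrite sumr_ge0 // => a _; rewrite exprn_ge0.
have := exprn_ge0 c q0; set S := \sum_(a < c) _ in S0 *.
move=> qc0 H; have : y * S <= (1 - q) * S by rewrite ler_wpM2r //; lra.
lra.
Qed.

Section FreshAverage.
Variables (R : realFieldType) (X V : finType) (c : nat) (T : X -> {set V}).
Hypothesis X0 : (0 < #|X|)%N.
Local Notation Omega := {ffun 'I_c -> X}.

Lemma avg_coord (g : X -> R) (a : 'I_c) : avg (fun w : Omega => g (w a)) = avg g.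
Proof.
rewrite (eq_avg (g := fun w : Omega => \prod_b (if b == a then g (w b) else 1))).
  rewrite (avg_prod (fun b x => if b == a then g x else 1)) // (bigD1 a) //= eqxx.
  by rewrite big1 ?mulr1 // => b /negPf ->; rewrite avg_cst.
by move=> w; rewrite (bigD1 a) //= eqxx big1 ?mulr1 // => b /negPf ->.
Qed.

(** [B] is fresh at [a] when colour [a] contains it and all earlier colours miss it; by independence
    the [a] earlier colours contribute a power. *)
Lemma avg_fresh (B : {set V}) (a : 'I_c) :
  avg (fun w : Omega => (B \subset fresh (fun b => T (w b)) a)%:R : R) =
  avg (fun x => (B \subset T x)%:R) * avg (fun x => [disjoint B & T x]%:R) ^+ a.
Proof.
pose g (b : 'I_c) (x : X) : R := if b == a then (B \subset T x)%:R else
  if (b < a)%N then [disjoint B & T x]%:R else 1.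
rewrite (eq_avg (g := fun w : Omega => \prod_b g b (w b))); last first.
  move=> w; rewrite (bigD1 a) //= {1}/g eqxx.
  rewrite /fresh subsetD -mulnb natrM; congr (_ * _).
  rewrite (eq_bigr (fun b : 'I_c => ((b < a)%N ==> [disjoint B & T (w b)])%:R)); last first.
    by move=> b /negPf ba; rewrite /g ba; case: ltnP => //=; case: (disjoint _ _).
  case: (boolP [disjoint B & _]) => [/bigcup_disjointP H|H].
    by rewrite big1 // => b _; case: ltnP => //= ba; rewrite H.
  have [b ba nd] : exists2 b : 'I_c, (b < a)%N & ~~ [disjoint B & T (w b)].
    apply/exists_inP; apply: contraR H; rewrite negb_exists_in => /forall_inP H.
    by apply/bigcup_disjointP => b ba; have := H _ ba; rewrite negbK.
  by rewrite (bigD1 b) /= ?ba ?(negPf nd) ?mul0r // -val_eqE /= ltn_eqF.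
rewrite avg_prod // (bigD1 a) //= {1}/g eqxx; congr (_ * _).
rewrite (eq_bigr (fun b : 'I_c => if (b < a)%N then avg (fun x => [disjoint B & T x]%:R) else 1)); last first.
  by move=> b /negPf ba; rewrite /g ba; case: ifP => // _; rewrite avg_cst.
rewrite -big_mkcondr /= (eq_bigl (fun b : 'I_c => (b < a)%N)); last first.
  by move=> b; rewrite -val_eqE /=; case: ltngtP.
rewrite -(big_ord_widen c (fun=> avg (fun x => [disjoint B & T x]%:R)) (ltnW (ltn_ord a))).
by rewrite prodr_const card_ord.
Qed.

End FreshAverage.

Section InclusionAverages.
Variables (R : realFieldType) (X V : finType) (W : X -> {set V}).

Definition incl_prob (B : {set V}) : R := avg (fun x => (B \subset W x)%:R).

Lemma avg_mom2_incl : avg (fun x => mom2 R (W x)) =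
  \sum_u \sum_w (u != w)%:R * incl_prob [set u; w].
Proof.
rewrite (eq_avg (fun x => mom2E R (W x))) avg_sum; apply: eq_bigr => u _.
rewrite avg_sum; apply: eq_bigr => w _; rewrite -avgZ.
by apply: eq_avg => x; rewrite -natrM mulnb.
Qed.

Lemma avg_mom3_at_incl u :
  avg (fun x => (u \in W x)%:R * ((#|W x|%:R - 1) * (#|W x|%:R - 2))) =
  \sum_w \sum_z [&& u != w, u != z & w != z]%:R * incl_prob [set u; w; z].
Proof.
rewrite (eq_avg (fun x => esym (mom3_at R (W x) u))) avg_sum; apply: eq_bigr => w _.
rewrite avg_sum; apply: eq_bigr => z _.
by rewrite -avgZ; apply: eq_avg => x; rewrite -natrM mulnb !andbA.
Qed.

Lemma avg_mom3_incl : avg (fun x => mom3 R (W x)) =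
  \sum_u \sum_w \sum_z [&& u != w, u != z & w != z]%:R * incl_prob [set u; w; z].
Proof.
rewrite (eq_avg (fun x => mom3E R (W x))) avg_sum; apply: eq_bigr => u _.
by rewrite -avg_mom3_at_incl; apply: eq_avg => x; rewrite -mom3_at.
Qed.

End InclusionAverages.

(** * The expected saving from the moments of a single colour *)

Section ExpectedSaving.
Variables (R : realFieldType) (X V : finType) (c K : nat) (W : X -> {set V}).
Hypothesis X0 : (0 < #|X|)%N.
Hypothesis K1 : (1 < K)%N.
Local Notation Omega := {ffun 'I_c -> X}.

Let T := trunc K W.
Local Notation incl B := (incl_prob R W B).
Let tincl (B : {set V}) : R := avg (fun x => (B \subset T x)%:R).
Let miss (B : {set V}) : R := avg (fun x => [disjoint B & T x]%:R).

Let tincl_le B : tincl B <= incl B.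
Proof.
apply: ler_avg => x; rewrite ler_nat; case BT: (B \subset T x) => //.
by rewrite (subset_trans BT) ?trunc_sub.
Qed.

Let tincl_ge0 B : 0 <= tincl B. Proof. by apply: avg_ge0 => x; rewrite ler0n. Qed.
Let miss_ge0 B : 0 <= miss B. Proof. by apply: avg_ge0 => x; rewrite ler0n. Qed.

Variables (p mu1 T2 y : R).
Hypothesis p2 : 2 * p <= 1.
Hypothesis inclp : forall u, incl [set u] <= p.
Let mu := avg (fun x => mom3 R (W x)).
Hypothesis mu1P : forall u,
  avg (fun x => (u \in W x)%:R * ((#|W x|%:R - 1) * (#|W x|%:R - 2))) <= mu1.
Hypothesis T2P : forall u w, u != w -> incl [set u; w] <= T2.
Hypothesis y0 : 0 < y.
Hypothesis yP : forall u w z, 0 < incl [set u; w; z] ->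
  y <= incl [set u] + incl [set w] + incl [set z] - 3 * (mu1 / (K%:R * (K%:R - 1))) - 3 * T2.

Let Kr : 2 <= K%:R :> R. Proof. by rewrite ler_nat. Qed.

Let K_lt (A : {set V}) : (K < #|A|)%N -> K%:R + 1 <= #|A|%:R :> R.
Proof. by move=> KA; rewrite natr1 ler_nat. Qed.

(** Markov's inequality, here and in the next two facts: truncation acts only when |W| > K, and
    there |W| - 1 >= K and |W| - 2 >= K - 1, so its effect is bounded by third moments. *)
Let tail1 u : incl [set u] - mu1 / (K%:R * (K%:R - 1)) <= tincl [set u].
Proof.
have KK : 0 < K%:R * (K%:R - 1) :> R by rewrite mulr_gt0 //; move: Kr; lra.
rewrite lerBlDr -lerBlDl; apply: le_trans (_ : avg (fun x => (u \in W x)%:R *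
   ((#|W x|%:R - 1) * (#|W x|%:R - 2)) / (K%:R * (K%:R - 1))) <= _); last first.
  by rewrite avgZr ler_pM2r ?invr_gt0.
rewrite -avgB; apply: ler_avg => x; rewrite !sub1set /T /trunc.
case: leqP => [_|Kx].
  rewrite subrr; apply: divr_ge0; last exact: ltW.
  by rewrite -mom3_at; do 2!(apply: sumr_ge0 => ? _).
rewrite inE subr0; case: (u \in W x); rewrite ?mul0r ?mul1r //.
rewrite ler_pdivlMr // mul1r.
have H := K_lt Kx; apply: ler_pM; move: Kr; lra.
Qed.

Let tail2 : avg (fun x => mom2 R (W x)) - mu / (K%:R - 1) <= avg (fun x => mom2 R (T x)).
Proof.
have KK : 0 < K%:R - 1 :> R by move: Kr; lra.
rewrite lerBlDr -avgZr -avgD; apply: ler_avg => x; rewrite /T /trunc.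
case: leqP => [_|Kx]; first by rewrite lerDl divr_ge0 ?mom3_ge0 // ltW.
rewrite {2}/mom2 cards0 mul0r add0r ler_pdivlMr // /mom3 -/(mom2 _ _).
by apply: ler_wpM2l; [exact: mom2_ge0|have := K_lt Kx; lra].
Qed.

Let tail0 : avg (fun x => (K < #|W x|)%:R) <= mu / ((K%:R + 1) * K%:R * (K%:R - 1)).
Proof.
have KK : 0 < (K%:R + 1) * K%:R * (K%:R - 1) :> R.
  by rewrite !mulr_gt0 //; move: Kr; lra.
rewrite -avgZr; apply: ler_avg => x; case: ltnP => [Kx|_]; last first.
  by rewrite divr_ge0 ?mom3_ge0 // ltW.
rewrite ler_pdivlMr // mul1r /mom3; have H := K_lt Kx.
by rewrite !ler_pM ?mulr_ge0 //; move: Kr; lra.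
Qed.

Let disjointsU (A B C : {set V}) :
  [disjoint A :|: B & C] = [disjoint A & C] && [disjoint B & C].
Proof. by rewrite -!setI_eq0 setIUl setU_eq0. Qed.

Let miss2 u w : 1 - 2 * p <= miss [set u; w].
Proof.
have := inclp u; have := inclp w.
have : 1 - incl [set u] - incl [set w] <= miss [set u; w].
  rewrite -[X in X - _ - _](avg_cst _ X0) -!avgB; apply: ler_avg => x.
  rewrite !sub1set disjointsU !disjoints1.
  have H v : v \in T x -> v \in W x by apply/subsetP/trunc_sub.
  case uT: (u \in T x).
    by rewrite (H u uT) /=; case: (w \in W x); rewrite /=; lra.
  case wT: (w \in T x).
    by rewrite (H w wT) /=; case: (u \in W x); rewrite /=; lra.
  by rewrite /=; case: (u \in W x); case: (w \in W x); rewrite /=; lra.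
lra.
Qed.

(** Bonferroni for the truncated classes: the three single terms lose the tail from [tail1], the
    pair terms are at most [T2]. A triple of probability 0 contributes nothing, so [y] has to be a
    valid bound only for the others. *)
Let miss3 u w z : u != w -> u != z -> w != z -> 0 < incl [set u; w; z] ->
  miss [set u; w; z] <= 1 - y.
Proof.
move=> uw uz wz /yP y_le.
have := tail1 u; have := tail1 w; have := tail1 z.
have := T2P uw; have := T2P uz; have := T2P wz.
have := tincl_le [set u; w]; have := tincl_le [set u; z]; have := tincl_le [set w; z].
have : miss [set u; w; z] <= 1 - tincl [set u] - tincl [set w] - tincl [set z]
   + tincl [set u; w] + tincl [set u; z] + tincl [set w; z].
  rewrite -[X in _ <= X - _ - _ - _ + _ + _ + _](avg_cst _ X0) -!avgB -!avgD.
  apply: ler_avg => x; rewrite !subUset !sub1set !disjointsU !disjoints1.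
  by case: (u \in T x); case: (w \in T x); case: (z \in T x); rewrite /=; lra.
lra.
Qed.

Let fr (w : Omega) := fresh (fun b => T (w b)).

Let avg_mom2 (a : 'I_c) : avg (fun w : Omega => mom2 R (fr w a)) =
  \sum_u \sum_w (u != w)%:R * (tincl [set u; w] * miss [set u; w] ^+ a).
Proof.
rewrite (eq_avg (fun w => mom2E R (fr w a))) avg_sum; apply: eq_bigr => u _.
rewrite avg_sum; apply: eq_bigr => w _; rewrite -(avg_fresh _ _ X0) -avgZ.
by apply: eq_avg => om; rewrite -natrM mulnb.
Qed.

Let avg_mom3 (a : 'I_c) : avg (fun w : Omega => mom3 R (fr w a)) =
  \sum_u \sum_w \sum_z [&& u != w, u != z & w != z]%:R *
    (tincl [set u; w; z] * miss [set u; w; z] ^+ a).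
Proof.
rewrite (eq_avg (fun w => mom3E R (fr w a))) avg_sum; apply: eq_bigr => u _.
rewrite avg_sum; apply: eq_bigr => w _; rewrite avg_sum; apply: eq_bigr => z _.
rewrite -(avg_fresh _ _ X0) -avgZ.
by apply: eq_avg => om; rewrite -natrM mulnb !andbA.
Qed.

Let avg_mom2T : avg (fun x => mom2 R (T x)) =
  \sum_u \sum_w (u != w)%:R * tincl [set u; w].
Proof. exact: avg_mom2_incl. Qed.

Let sum_mom2 : (\sum_(a < c) (1 - 2 * p) ^+ a) * avg (fun x => mom2 R (T x)) <=
  \sum_(a < c) avg (fun w : Omega => mom2 R (fr w a)).
Proof.
rewrite avg_mom2T; under [leRHS]eq_bigr do rewrite avg_mom2.
rewrite [leRHS]exchange_big mulr_sumr; apply: ler_sum => u _ /=.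
rewrite [leRHS]exchange_big mulr_sumr; apply: ler_sum => w _ /=.
rewrite -mulr_sumr mulrCA ler_wpM2l // -mulr_sumr mulrC ler_wpM2l //.
apply: ler_sum => a _; apply: lerXn2r; rewrite ?nnegrE ?miss_ge0 ?miss2 //.
by move: p2; lra.
Qed.

Let sum_mom3 : \sum_(a < c) avg (fun w : Omega => mom3 R (fr w a)) <= mu / y.
Proof.
rewrite /mu avg_mom3_incl mulr_suml; under [leLHS]eq_bigr do rewrite avg_mom3.
rewrite [leLHS]exchange_big; apply: ler_sum => u _ /=; rewrite mulr_suml.
rewrite [leLHS]exchange_big; apply: ler_sum => w _ /=; rewrite mulr_suml.
rewrite [leLHS]exchange_big; apply: ler_sum => z _ /=.
rewrite -mulr_sumr -mulrA; case: (boolP [&& _, _ & _]); last by rewrite !mul0r.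
move=> /and3P[uw uz wz]; rewrite !mul1r -mulr_sumr.
set B := [set u; w; z]; have := tincl_le B; have := tincl_ge0 B.
have [B0|B0] := leP (incl B) 0; move=> t0 tB.
  have -> : tincl B = 0 by apply/le_anti; rewrite t0 (le_trans tB).
  by rewrite mul0r; apply: divr_ge0; [exact: le_trans t0 tB | exact: ltW].
rewrite ler_pM ?sumr_ge0 // => [a _|]; first by rewrite exprn_ge0.
by rewrite geometric_sum_le // miss_ge0 miss3.
Qed.

(** Pairs enter from below, through [miss2] and the finite geometric sum; triples from above,
    through the full series 1/y. The last term bounds the expected number of discarded colours. *)
Lemma expected_truncated_saving :
  (\sum_(a < c) (1 - 2 * p) ^+ a) / 2 * (avg (fun x => mom2 R (W x)) - mu / (K%:R - 1))
  - mu / (6 * y) - c%:R * (mu / ((K%:R + 1) * K%:R * (K%:R - 1)))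
  <= avg (fun w : Omega => truncated_saving R K W w).
Proof.
rewrite /truncated_saving avgB; apply: lerB; last first.
  rewrite (eq_avg (g := fun w : Omega => \sum_(a < c) (K < #|W (w a)|)%:R)); last first.
    by move=> w; rewrite natr_sum.
  rewrite avg_sum (eq_bigr (fun=> avg (fun x => (K < #|W x|)%:R))); last first.
    by move=> a _; rewrite (avg_coord X0 (fun x => (K < #|W x|)%:R)).
  rewrite sumr_const card_ord -(mulr_natl (avg _)) ler_wpM2l //.
rewrite (eq_avg (g := fun w : Omega => \sum_(a < c) (#|fr w a|.-1)%:R)); last first.
  by move=> w; rewrite natr_sum.
rewrite avg_sum; apply: le_trans (_ : \sum_(a < c)
   (avg (fun w : Omega => mom2 R (fr w a)) / 2 - avg (fun w : Omega => mom3 R (fr w a)) / 6) <= _).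
  rewrite sumrB -!mulr_suml; apply: lerB; last first.
    rewrite (_ : mu / (6 * y) = mu / y / 6) ?ler_pM2r ?invr_gt0 //. 
    by rewrite [6 * y]mulrC invfM mulrA.
  rewrite mulrAC ler_pM2r ?invr_gt0 // (le_trans _ sum_mom2) // ler_wpM2l //.
  by apply: sumr_ge0 => a _; apply: exprn_ge0; move: p2; lra.
apply: ler_sum => a _; rewrite -!avgZr -avgB; apply: ler_avg => w.
exact: bonferroni.
Qed.

End ExpectedSaving.

(** * Numerical estimates *)

(** Squaring 1 + 1.929/64 <= exp(1.929/64) six times, rounding down each time, gives exp(1.929) >=
    6.55. *)
Lemma expR_decay (R : realType) : expR (- (1929 / 1000)) <= 153 / 1000 :> R.
Proof.
have dbl (b a x : R) : 0 <= a -> b <= a * a -> a <= expR x -> b <= expR (2 * x).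
  by move=> a0 ba ax; rewrite mulr_natl mulr2n expRD (le_trans ba) // ler_pM.
pose y : R := 1929 / 1000 / 64.
have H : 10301 / 10000 <= expR y by apply: le_trans (expR_ge1Dx _); rewrite /y; lra.
have {}H : 1061 / 1000 <= expR (2 * y) by apply: dbl H; lra.
have {}H : 1125 / 1000 <= expR (2 * (2 * y)) by apply: dbl H; lra.
have {}H : 1265 / 1000 <= expR (2 * (2 * (2 * y))) by apply: dbl H; lra.
have {}H : 1600 / 1000 <= expR (2 * (2 * (2 * (2 * y)))) by apply: dbl H; lra.
have {}H : 256 / 100 <= expR (2 * (2 * (2 * (2 * (2 * y))))) by apply: dbl H; lra.
have {}H : 655 / 100 <= expR (2 * (2 * (2 * (2 * (2 * (2 * y)))))) by apply: dbl H; lra.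
have yE : 2 * (2 * (2 * (2 * (2 * (2 * y))))) = 1929 / 1000 by rewrite /y; field.
rewrite yE in H; have : expR (- (1929 / 1000)) * expR (1929 / 1000) = 1 :> R.
  by rewrite -expRD addNr expR0.
have := expR_gt0 (- (1929 / 1000) : R).
move: H; set a := expR (1929 / 1000); set b := expR _ => H b0 ab.
have : b * (655 / 100) <= b * a by rewrite ler_pM2l.
lra.
Qed.

(** Here [n] is r + 1, [m] a union size and [t] the number of triangles on a pair. Trading [m] for a
    form linear in [t] leaves only counts of edges and triangles; 247 = 2 * 335 - 423 makes the
    bound exact at m = t = n as well as at m = 2n, t = 0. *)
Lemma pair_gain (R : realFieldType) (n m t : R) : 0 < n -> n <= m -> m <= 2 * n -> 0 <= t -> t <= n ->
  (423 / 1000 - 247 / 1000 * (t / n)) / (2 * n) <=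
  423 / 1000 / m - 335 / 1000 * (t / m ^+ 2).
Proof.
move=> n0 nm m2 t0 tn.
have m0 : 0 < m by apply: lt_le_trans nm.
pose z := n / m; pose s := t / n.
have z1 : z <= 1 by rewrite /z ler_pdivrMr // mul1r.
have z2 : 1 <= 2 * z by rewrite /z mulrA ler_pdivlMr // mul1r.
have s0 : 0 <= s by rewrite divr_ge0 // ltW.
have s1 : s <= 1 by rewrite /s ler_pdivrMr // mul1r.
have -> : 423 / 1000 / m - 335 / 1000 * (t / m ^+ 2) =
  (423 / 1000 * z - 335 / 1000 * (s * z ^+ 2)) / n.
  by rewrite /z /s; field; rewrite !gt_eqF.
have -> : (423 / 1000 - 247 / 1000 * (t / n)) / (2 * n) =
  (2115 / 10000 - 1235 / 10000 * s) / n.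
  by rewrite /s; field; rewrite !gt_eqF.
rewrite ler_pM2r ?invr_gt0 //.
have H1 : 0 <= (1 - z) * s by apply: mulr_ge0 => //; lra.
have H2 : 0 <= (2 * z - 1) * (1 - s) by apply: mulr_ge0; lra.
have H3 : 0 <= s * ((2 * z - 1) * (1 - z)).
  by apply: mulr_ge0 => //; apply: mulr_ge0; lra.
(* The right-hand side is concave in [z]; the left-hand side is a lower bound at both ends of
   [1/2, 1]. *)
rewrite -subr_ge0.
have -> : 423 / 1000 * z - 335 / 1000 * (s * z ^+ 2) - (2115 / 10000 - 1235 / 10000 * s) =
  795 / 10000 * ((1 - z) * s) + 2115 / 10000 * ((2 * z - 1) * (1 - s))
   + 1675 / 10000 * (s * ((2 * z - 1) * (1 - z))) by field.
by apply: addr_ge0; [apply: addr_ge0|]; apply: mulr_ge0 => //; apply: divr_ge0.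
Qed.


(** By 1 - 2/n <= exp(-2/n) the last power is at most exp(-2c/n), and 2c/n >= 1.929 for such [r];
    847/1000 is 1 - 153/1000. *)
Lemma geometric_sum_ge (R : realType) (c : nat) (n r : R) : 100 * 100 <= r ->
  n = r + 1 -> 965 / 1000 * r - 1 <= c%:R ->
  847 / 2000 * n <= \sum_(a < c) (1 - 2 * n^-1) ^+ a.
Proof.
move=> r_large nr hc; have n0 : 0 < n by lra.
set q := 1 - 2 * n^-1.
have E : n / 2 * (1 - q ^+ c) = \sum_(a < c) q ^+ a.
  rewrite -[1 - _]opprB subrX1 -mulNr opprB mulrA.
  by rewrite (_ : n / 2 * (1 - q) = 1) ?mul1r // /q; field; rewrite gt_eqF.
rewrite -E; suff : q ^+ c <= 153 / 1000.
  move=> qc; have : n * (847 / 1000) <= n * (1 - q ^+ c) by rewrite ler_pM2l //; lra.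
  lra.
apply: le_trans (expR_decay R).
have q_le : q <= expR (- (2 * n^-1)) by apply: expR_ge1Dx.
have q0 : 0 <= q.
  by rewrite /q subr_ge0 -/(2 / n) ler_pdivrMr //; lra.
apply: le_trans (_ : expR (- (2 * n^-1)) ^+ c <= _).
  by rewrite lerXn2r ?nnegrE ?expR_ge0.
rewrite -expRM_natl ler_expR mulrN lerN2 mulrA -/(_ / n) ler_pdivlMr //; lra.
Qed.

(** The truncation losses are at most n/4000 and n/10000, which fits between 0.0365 r and 0.036
    r. *)
Lemma saving_arithmetic (R : realFieldType) (r n G m s1 s2 mu c K : R) :
  73 / 2000 * r <= 847 / 2000 * n / 2 * s1 - s2 / (6 * (299 / 100 / n)) ->
  0 <= s1 -> s1 <= m -> mu <= s2 -> 0 <= mu -> mu <= 7 ->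
  100 * 100 <= r -> n = r + 1 -> c <= r -> 0 <= c -> 100 * 100 <= K ->
  847 / 2000 * n <= G -> G <= n / 2 ->
  36 / 1000 * r <= G / 2 * (m - mu / (K - 1)) - mu / (6 * (299 / 100 / n))
    - c * (mu / ((K + 1) * K * (K - 1))).
Proof.
move=> g s10 m2 mug mu0 mu7 r_large nr c_le c0 K_large G_ge G_le.
have n0 : 0 < n by clear -nr r_large; lra.
have G0 : 0 <= G by clear -G_ge n0; lra.
have Gn : G / 2 <= n / 4 by clear -G_le; lra.
have cn : c <= n by clear -nr c_le; lra.
have h1 : 847 / 2000 * n / 2 * s1 <= G / 2 * m.
  apply: ler_pM => //; last by rewrite ler_pM2r ?invr_gt0.
  by apply: divr_ge0 => //; apply: mulr_ge0; [apply: divr_ge0|exact: ltW].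
have h2 : mu / (6 * (299 / 100 / n)) <= s2 / (6 * (299 / 100 / n)).
  by rewrite ler_pM2r // invr_gt0 mulr_gt0 // !divr_gt0.
have Km : 70 * 100 <= K - 1 by clear -K_large; lra.
have Km0 : 0 < K - 1 by clear -Km; lra.
have KK : 1 <= (K + 1) * K.
  by rewrite -[leLHS]mulr1; apply: ler_pM => //; clear -Km; lra.
have b0 : 0 <= mu / (K - 1) by rewrite divr_ge0 // ltW.
have b1 : mu / (K - 1) <= 1 / 1000 by rewrite ler_pdivrMr //; clear -Km mu7; lra.
have h3 : G / 2 * (mu / (K - 1)) <= n / 4 * (1 / 1000).
  by apply: ler_pM => //; apply: divr_ge0.
have K3 : K - 1 <= (K + 1) * K * (K - 1) by rewrite ler_peMl // ltW.
have K3' : 0 < (K + 1) * K * (K - 1) by apply: lt_le_trans Km0 K3.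
have d1 : mu / ((K + 1) * K * (K - 1)) <= mu / (K - 1).
  by apply: ler_wpM2l => //; rewrite lef_pV2.
have KK2 : 10 <= (K + 1) * K.
  by rewrite -[leLHS]mulr1; apply: ler_pM => //; clear -Km; lra.
have d2 : mu / ((K + 1) * K * (K - 1)) <= 1 / 1000 / 10.
  rewrite invfM mulrCA mulrC; apply: ler_pM => //; first by rewrite invr_ge0; apply: le_trans KK.
  by rewrite lef_pV2 ?posrE //; apply: lt_le_trans KK.
have h4 : c * (mu / ((K + 1) * K * (K - 1))) <= n * (1 / 1000 / 10).
  by apply: ler_pM => //; rewrite divr_ge0 // ltW.
rewrite mulrBr; move: g h1 h2 h3 h4.
set x1 := _ * s1; set x2 := s2 / _; set x3 := mu / _; set x4 := G / 2 * (mu / _).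
by set x5 := c * _; clearbody x1 x2 x3 x4 x5; clear -r_large nr; lra.
Qed.

Lemma leq_bound (r m : nat) : (m <= 2 * r.+1 -> m < 2 * r + 4)%N.
Proof. lia. Qed.

Lemma max_of_three (a b c : nat) :
  (1 <= (a <= c) && (b <= c) + (a <= b) && (c <= b) + (b <= a) && (c <= a))%N.
Proof. by case: (leqP a c); case: (leqP b c); case: (leqP a b) => //=; lia. Qed.

(** * The expected saving around one vertex *)

Section NeighbourhoodSaving.
Variables (R : realType) (V : finType) (N : V -> {set V}) (r L : nat).
Hypothesis NV : forall u, #|N u| = r.
Hypothesis N_irrefl : forall u, u \notin N u.
Hypothesis N_sym : forall u w, (u \in N w) = (w \in N u).
Hypothesis L0 : (0 < L)%N.
Local Notation X := {ffun V -> 'I_L}.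
Local Notation n := (r.+1%:R : R).

Variable eps : R.
Hypothesis eps_low : forall m, (m <= 2 * r + 4)%N -> 1 - eps <= (L.-2%:R / L%:R) ^+ m.
Hypothesis eps_up : forall m, (m <= 2 * r + 4)%N -> (L.+2%:R / L%:R) ^+ m <= 1 + eps.
Hypothesis eps0 : 0 < eps <= 1 / 1000.

Definition locals (x : X) : {set V} := [set u | local_max N x u].

Variable v : V.
Definition nbr_locals (x : X) : {set V} := locals x :&: N v.

(** Adjacency in the non-adjacency graph on [N v]; [far_deg] counts its triangles on a pair. Below,
    [F2] is twice its number of edges and [F3] six times its number of triangles. *)
Definition far u w := [&& u \in N v, w \in N v, u != w & w \notin N u].
Definition far_deg u w : R := \sum_z (far u z && far w z)%:R.
Local Notation M u w := ((union_size N r u w)%:R : R).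
Local Notation incl B := (incl_prob R nbr_locals B).

Let X0 : (0 < #|X|)%N. Proof. by rewrite card_ffun card_ord expn_gt0 L0. Qed.

Lemma farC u w : far u w = far w u.
Proof. by rewrite /far [w \in N u]N_sym [u == w]eq_sym andbCA. Qed.

Lemma locals_indep x u w : u \in locals x -> w \in locals x -> w \notin N u.
Proof.
rewrite !inE => /forall_inP lu /forall_inP lw; apply/negP => wu.
by have := ltn_trans (lu w wu) (lw u _); rewrite ltnn N_sym => /(_ wu).
Qed.

Let union_size_le u w : (union_size N r u w <= 2 * r.+1)%N.
Proof.
have : (#|N u :\: N w| <= r)%N by rewrite -(NV u) subset_leq_card // subsetDl.
by rewrite /union_size; lia.
Qed.

Let M_le u w : M u w <= 2 * n.
Proof. by rewrite -natrM ler_nat. Qed.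

Let M_ge u w : n <= M u w.
Proof. by rewrite ler_nat /union_size; lia. Qed.

Let n_gt0 : 0 < n. Proof. by rewrite ltr0n. Qed.
Let M_gt0 u w : 0 < M u w. Proof. exact: lt_le_trans (M_ge u w). Qed.

Let incl1 u : u \in N v -> incl [set u] = prob1 R r L.
Proof.
move=> uN; rewrite -(avg_local_max R NV N_irrefl L0 u); apply: eq_avg => x.
by rewrite sub1set !inE uN andbT.
Qed.

Let incl1_le u : incl [set u] <= n^-1.
Proof.
have [uN|uN] := boolP (u \in N v); first by rewrite incl1 // prob1_le.
rewrite /incl_prob (eq_avg (g := fun=> 0)) ?avg_cst // ?invr_ge0 // => x.
by rewrite sub1set !inE (negPf uN) andbF.
Qed.

Let incl1_ge u : u \in N v -> (1 - eps) / n <= incl [set u].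
Proof.
move=> uN; rewrite incl1 //; apply: le_trans (prob1_ge R r L0).
rewrite ler_pM2r ?invr_gt0 // (le_trans (eps_low (m := r.+1) _)) //.
  by apply/ltnW/leq_bound; rewrite mul2n -addnn leq_addl.
rewrite lerXn2r // ?nnegrE ?divr_ge0 // ler_pM2r ?invr_gt0 ?ltr0n // ler_nat.
by case: L => [|[]].
Qed.

Let incl2_ge u w : far u w -> (1 - eps) * (2 / (n * M u w)) <= incl [set u; w].
Proof.
move=> /and4P[uN wN uw wu].
rewrite (_ : incl [set u; w] = avg (fun x : X => (local_max N x u && local_max N x w)%:R)).
  apply: le_trans (avg_local_max2_ge R NV N_irrefl N_sym L0 uw wu).
  rewrite ler_pM2r ?divr_gt0 ?mulr_gt0 // eps_low //.
  exact: ltnW (leq_bound (union_size_le u w)).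
by apply: eq_avg => x; rewrite subUset !sub1set !inE uN wN !andbT.
Qed.

Let incl_ge0 B : 0 <= incl B. Proof. by apply: avg_ge0 => x; rewrite ler0n. Qed.

Let incl_notfar (B : {set V}) u w : u \in B -> w \in B -> u != w -> ~~ far u w ->
  incl B = 0.
Proof.
move=> uB wB uw nf; rewrite /incl_prob (eq_avg (g := fun=> 0)) ?avg_cst // => x.
have [BW|//] := boolP (B \subset _); case/negP: nf.
have := subsetP BW u uB; have := subsetP BW w wB.
rewrite [w \in _]inE [u \in _]inE => /andP[lw wN] /andP[lu uN].
by rewrite /far uN wN uw (locals_indep lu lw).
Qed.

Let incl2_le u w : u != w -> incl [set u; w] <= (1 + eps) * 2 / n ^+ 2.
Proof.
move=> uw; have e0 : 0 <= (1 + eps) * 2 / n ^+ 2.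
  by rewrite divr_ge0 ?exprn_ge0 // mulr_ge0 //; move: eps0; lra.
have [|nf] := boolP (far u w); last first.
  by rewrite (@incl_notfar _ u w) // !inE eqxx ?orbT.
move=> /and4P[uN wN _ wu].
rewrite (_ : incl [set u; w] = avg (fun x : X => (local_max N x u && local_max N x w)%:R)).
  apply: le_trans (avg_local_max2_le R NV N_irrefl N_sym L0 uw wu) _.
  rewrite -mulrA; apply: ler_pM; rewrite ?exprn_ge0 ?divr_ge0 ?mulr_ge0 //.
    apply: le_trans (eps_up (m := union_size N r u w) _).
      by rewrite lerXn2r // ?nnegrE ?divr_ge0 // ler_pM2r ?invr_gt0 ?ltr0n // ler_nat.
    exact: ltnW (leq_bound (union_size_le u w)).
  rewrite ler_pM2l // lef_pV2 ?posrE ?exprn_gt0 ?mulr_gt0 // expr2 ler_pM2l //.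
by apply: eq_avg => x; rewrite subUset !sub1set !inE uN wN !andbT.
Qed.

Let gam u w : R := 2 / (n * M u w ^+ 2).

Let gam_le u w : gam u w <= 2 / n ^+ 3.
Proof.
rewrite /gam ler_pM2l // lef_pV2 ?posrE ?mulr_gt0 ?exprn_gt0 //.
by rewrite [n ^+ 3]exprS ler_pM2l // lerXn2r // nnegrE ltW.
Qed.

Let gam_ge0 u w : 0 <= gam u w.
Proof. by rewrite divr_ge0 // mulr_ge0 // exprn_ge0. Qed.

Let max2_le u w z : far u w -> far u z -> far w z ->
  avg (fun x : X => [&& local_max N x u, local_max N x w, (x u <= x z)%N & (x w <= x z)%N]%:R : R)
  <= (1 + eps) * gam u w.
Proof.
move=> /and4P[uN wN uw wu] /and4P[_ zN uz zu] /and4P[_ _ wz zw].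
apply: le_trans (avg_max_local_max2_le R NV N_irrefl N_sym L0 uw wu uz wz zu zw) _.
apply: ler_pM; rewrite ?exprn_ge0 ?divr_ge0 ?mulr_ge0 //.
  exact: eps_up (leq_bound (union_size_le u w)).
rewrite ler_pM2l // lef_pV2 ?posrE ?mulr_gt0 ?exprn_gt0 //.
by rewrite -mulrA ler_pM2l // expr2 ler_pM2l // ler_nat.
Qed.

(** Some vertex of the triple carries the largest label; the three terms are the three choices, each
    retaining local maximality of the other two only. *)
Let incl3_le u w z : u != w -> u != z -> w != z ->
  incl [set u; w; z] <= [&& far u w, far u z & far w z]%:R *
    ((1 + eps) * (gam u w + gam u z + gam w z)).
Proof.
move=> uw uz wz.
have [fuw|nf] := boolP (far u w); last first.
  by rewrite (@incl_notfar _ u w) ?mul0r // !inE eqxx ?orbT.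
have [fuz|nf] := boolP (far u z); last first.
  by rewrite (@incl_notfar _ u z) ?mul0r // !inE eqxx ?orbT.
have [fwz|nf] := boolP (far w z); last first.
  by rewrite (@incl_notfar _ w z) ?mul0r // !inE eqxx ?orbT.
rewrite mul1r !mulrDr; have fwu : far w u by rewrite farC.
have fzw : far z w by rewrite farC.
have fzu : far z u by rewrite farC.
have H1 := max2_le fuw fuz fwz.
have H2 := max2_le fuz fuw fzw.
have H3 := max2_le fwz fwu fzu.
apply: le_trans (lerD (lerD H1 H2) H3); rewrite -!avgD; apply: ler_avg => x.
rewrite -!natrD ler_nat !subUset !sub1set !inE.
case: (local_max N x u) => //; case: (local_max N x w); last by rewrite /= andbF.
case: (local_max N x z); last by rewrite /= !andbF.
have [-> -> ->] : [/\ u \in N v, w \in N v & z \in N v].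
  by case/and4P: fuw => -> -> _ _; case/and4P: fuz => _ ->.
exact: max_of_three.
Qed.

Let mu := avg (fun x : X => mom3 R (nbr_locals x)).

Let incl_out (B : {set V}) u : u \in B -> u \notin N v -> incl B = 0.
Proof.
move=> uB uN; rewrite /incl_prob (eq_avg (g := fun=> 0)) ?avg_cst // => x.
have [BW|//] := boolP (B \subset _); case/negP: uN.
by have := subsetP BW u uB; rewrite inE => /andP[].
Qed.

Local Notation e u w := ((far u w)%:R : R).
Let F2 : R := \sum_u \sum_w e u w.
Let F3 : R := \sum_u \sum_w e u w * far_deg u w.
Let tri u w z : R := e u w * e u z * e w z.

Let F3E : F3 = \sum_u \sum_w \sum_z tri u w z.
Proof.
apply: eq_bigr => u _; apply: eq_bigr => w _; rewrite mulr_sumr.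
by apply: eq_bigr => z _; rewrite /tri -mulnb natrM mulrA.
Qed.

(* The triangles at [x] number at most [a ^+ 2] and at most [F2], hence at most [a * sqrt F2];
   the square root is linearized at [F2 = r ^+ 2 / 4]. *)
Let sum_tri_le (x : V) (a := \sum_w e x w) :
  \sum_w \sum_z tri x w z <= a * (F2 / r%:R + r%:R / 4).
Proof.
set S := \sum_w _; have e_le w z : 0 <= e w z <= 1 by case: far; rewrite ler0n ?lexx ?ler01.
have a0 : 0 <= a by apply: sumr_ge0.
have F20 : 0 <= F2 by do 2!(apply: sumr_ge0 => ? _).
have S0 : 0 <= S by do 2!(apply: sumr_ge0 => ? _); rewrite /tri !mulr_ge0.
have SF : S <= F2.
  apply: ler_sum => w _; apply: ler_sum => z _; rewrite /tri.
  by rewrite ler_piMl // mulr_ile1 //; case/andP: (e_le x w); case/andP: (e_le x z).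
have Sa : S <= a * a.
  rewrite /a big_distrlr; apply: ler_sum => w _; apply: ler_sum => z _.
  by rewrite /tri ler_piMr ?mulr_ge0 //; case/andP: (e_le w z).
have [r0|r0] := posnP r.
  rewrite /S big1; first by rewrite mulr_ge0 // addr_ge0 // divr_ge0.
  move=> w _; rewrite big1 // => z _; rewrite /tri /far.
  have := NV v; rewrite r0 => /eqP; rewrite cards_eq0 => /eqP ->.
  by rewrite inE !mul0r.
have rr : 0 < r%:R :> R by rewrite ltr0n.
set b := F2 / r%:R + r%:R / 4.
have b0 : 0 <= b by rewrite addr_ge0 // divr_ge0.
have Fb : F2 <= b ^+ 2.
  have -> : b ^+ 2 = F2 + (F2 / r%:R - r%:R / 4) ^+ 2 by rewrite /b; field; rewrite gt_eqF.
  by rewrite lerDl sqr_ge0.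
rewrite -ler_sqr ?nnegrE ?mulr_ge0 // expr2 exprMn expr2.
apply: ler_pM => //; exact: le_trans SF Fb.
Qed.

Let F3_le : F3 <= F2 * (F2 / r%:R + r%:R / 4).
Proof. by rewrite F3E mulr_suml; apply: ler_sum => x _; apply: sum_tri_le. Qed.

Let far_deg_le u w : 0 <= far_deg u w <= n.
Proof.
rewrite sumr_ge0 //= /far_deg -natr_sum ler_nat -(leq_add2r 0) addn0 addn0.
apply: leq_trans (leqnSn r); rewrite -(NV v) -sum1_card [leqRHS]big_mkcond.
by apply: leq_sum => z _; rewrite /far; case: (z \in N v); rewrite ?andbF //= leq_b1.
Qed.

Let mu_le_gam : mu <= 3 * (1 + eps) * \sum_u \sum_w e u w * (gam u w * far_deg u w).
Proof.
pose T g := \sum_u \sum_w \sum_z tri u w z * g u w z : R.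
have T1 : T (fun u w z => gam u w) = \sum_u \sum_w e u w * (gam u w * far_deg u w).
  apply: eq_bigr => u _; apply: eq_bigr => w _; rewrite mulr_sumr mulr_sumr.
  apply: eq_bigr => z _; rewrite /tri -mulnb natrM.
  by move: (gam u w) => g; rewrite -!mulrA; congr (_ * _); rewrite [RHS]mulrC -mulrA.
have T2 : T (fun u w z => gam u z) = T (fun u w z => gam u w).
  apply: eq_bigr => u _; rewrite exchange_big; apply: eq_bigr => w _; apply: eq_bigr => z _.
  by rewrite /tri [far z w]farC [e u z * _]mulrC.
have T3 : T (fun u w z => gam w z) = T (fun u w z => gam u z).
  rewrite /T exchange_big; apply: eq_bigr => w _; apply: eq_bigr => u _; apply: eq_bigr => z _.
  by rewrite /tri [far u w]farC -!mulrA [e u z * _]mulrCA.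
have -> : 3 * (1 + eps) * \sum_u \sum_w e u w * (gam u w * far_deg u w) =
    (1 + eps) * (T (fun u w z => gam u w) + T (fun u w z => gam u z) + T (fun u w z => gam w z)).
  by rewrite T3 T2 T1; ring.
rewrite /mu avg_mom3_incl /T -!big_split mulr_sumr; apply: ler_sum => u _ /=.
rewrite -!big_split mulr_sumr; apply: ler_sum => w _ /=.
rewrite -!big_split mulr_sumr; apply: ler_sum => z _ /=.
have e1 : 0 <= 1 + eps by move: eps0; lra.
have [/and3P[uw uz wz]|_] := boolP [&& u != w, u != z & w != z]; last first.
  by rewrite mul0r mulr_ge0 // !addr_ge0 // mulr_ge0 ?gam_ge0 // /tri !mulr_ge0.
rewrite mul1r; apply: le_trans (incl3_le uw uz wz) _.
rewrite -(mulnb (far u w)) -(mulnb (far u z)) !natrM /tri le_eqVlt; apply/orP; left; apply/eqP.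
by move: (gam u w) (gam u z) (gam w z) => g1 g2 g3; ring.
Qed.

Hypothesis sparse : \sum_(u in N v) \sum_(w in N v) ((u == w) || (w \in N u))%:R <=
  3 / 4 * r%:R ^+ 2 + r%:R :> R.
Hypothesis r_large : 100 * 100 <= r%:R :> R.

Let nr : n = r%:R + 1. Proof. by rewrite natr1. Qed.

(** The sum in [sparse] includes the diagonal, so [F2] is exactly its complement in r^2. *)
Let F2_bounds : r%:R ^+ 2 / 4 - r%:R <= F2 <= r%:R ^+ 2.
Proof.
have E : \sum_(u in N v) \sum_(w in N v) 1 = r%:R ^+ 2 :> R.
  under eq_bigr do rewrite sumr_const NV.
  by rewrite sumr_const NV -mulrnA expr2 -natrM.
have F2E : F2 = \sum_(u in N v) \sum_(w in N v) (1 - ((u == w) || (w \in N u))%:R).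
  rewrite [RHS]big_mkcond; apply: eq_bigr => u _; rewrite /far.
  case: (u \in N v); last by rewrite big1.
  rewrite [RHS]big_mkcond; apply: eq_bigr => w _ /=.
  by case: (w \in N v) => //=; case: eqP => //=; case: (w \in N u); rewrite ?subrr ?subr0.
have F2D : F2 = r%:R ^+ 2 - \sum_(u in N v) \sum_(w in N v) ((u == w) || (w \in N u))%:R.
  rewrite F2E -E -sumrB; apply: eq_bigr => u _; exact: sumrB.
have S0 : 0 <= \sum_(u in N v) \sum_(w in N v) ((u == w) || (w \in N u))%:R :> R.
  by do 2!(apply: sumr_ge0 => ? _).
by move: S0 sparse F2D; set S := \sum_(u in N v) _; lra.
Qed.


(** Serves the truncation errors, where the size of [K] forgives the crude constant: 6 (1 + eps) <=
    7. *)
Let incl3_le_crude u w z : u != w -> u != z -> w != z ->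
  incl [set u; w; z] <= ((u \in N v) && (w \in N v) && (z \in N v))%:R * (7 / n ^+ 3).
Proof.
move=> uw uz wz; apply: le_trans (incl3_le uw uz wz) _.
have n3 : 0 < n ^+ 3 by rewrite exprn_gt0.
have [/and3P[fuw fuz fwz]|_] := boolP [&& _, _ & _]; last first.
  by rewrite mul0r mulr_ge0 ?ler0n // divr_ge0 // ltW.
have /and4P[-> -> _ _] := fuw; have /and4P[_ -> _ _] := fuz.
rewrite !mul1r ler_pdivlMr //.
have g3 a b : gam a b * n ^+ 3 <= 2 by rewrite -ler_pdivlMr.
have H : (gam u w + gam u z + gam w z) * n ^+ 3 <= 6.
  by rewrite !mulrDl; have := g3 u w; have := g3 u z; have := g3 w z; lra.
rewrite -mulrA; apply: le_trans (ler_wpM2l _ H) _; move: eps0; lra.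
Qed.

Let sum_in_le : \sum_(z : V) (z \in N v)%:R <= n.
Proof.
rewrite -natr_sum ler_nat; apply: leq_trans (leqnSn r).
by rewrite -(NV v) -sum1_card [leqRHS]big_mkcond; apply: leq_sum => z _; case: (z \in N v).
Qed.

Let mu1_le u : avg (fun x : X => (u \in nbr_locals x)%:R *
  ((#|nbr_locals x|%:R - 1) * (#|nbr_locals x|%:R - 2))) <= (u \in N v)%:R * (7 / n).
Proof.
have n3 : 0 <= 7 / n ^+ 3 by rewrite divr_ge0 ?exprn_ge0.
rewrite avg_mom3_at_incl.
apply: le_trans (_ : \sum_w \sum_z (u \in N v)%:R * ((w \in N v)%:R * ((z \in N v)%:R * (7 / n ^+ 3))) <= _).
  apply: ler_sum => w _; apply: ler_sum => z _.
  have [/and3P[uw uz wz]|_] := boolP [&& u != w, u != z & w != z]; last first.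
    by rewrite mul0r; do 3!(apply: mulr_ge0 => //).
  by rewrite mul1r (le_trans (incl3_le_crude uw uz wz)) // -!mulnb !natrM !mulrA.
under eq_bigr do rewrite -!mulr_sumr -mulr_suml.
rewrite -mulr_sumr -mulr_suml ler_wpM2l //.
have -> : 7 / n = n * (n * (7 / n ^+ 3)).
  by move: n_gt0; move: n => y y0; field; rewrite gt_eqF.
have S0 : 0 <= \sum_(z : V) (z \in N v)%:R :> R by apply: sumr_ge0.
apply: ler_pM => //; first exact: mulr_ge0.
exact: ler_wpM2r.
Qed.

Let mu_le7 : mu <= 7.
Proof.
rewrite /mu (_ : avg _ = \sum_u avg (fun x : X => (u \in nbr_locals x)%:R *
  ((#|nbr_locals x|%:R - 1) * (#|nbr_locals x|%:R - 2)))).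
  apply: le_trans (ler_sum _ (fun u _ => mu1_le u)) _.
  rewrite -mulr_suml; apply: le_trans (ler_wpM2r _ sum_in_le) _.
    by rewrite divr_ge0.
  by rewrite mulrCA divff ?mulr1 // gt_eqF.
rewrite avg_mom3_incl; apply: eq_bigr => u _; by rewrite avg_mom3_at_incl.
Qed.

Let mu_ge0 : 0 <= mu.
Proof. by apply: avg_ge0 => x; apply: mom3_ge0. Qed.

Let mom2_ge : (1 - eps) * \sum_u \sum_w e u w * (2 / (n * M u w)) <=
  avg (fun x : X => mom2 R (nbr_locals x)).
Proof.
rewrite avg_mom2_incl mulr_sumr; apply: ler_sum => u _; rewrite mulr_sumr.
apply: ler_sum => w _; case fuw: (far u w); last by rewrite mul0r mulr0 mulr_ge0.
by have /and4P[_ _ -> _] := fuw; rewrite !mul1r incl2_ge.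
Qed.

(** Term by term this is [pair_gain]: the pair coefficient 0.4235 (1 - eps) is at least 0.423, and
    the triple coefficient (1 + eps)/2.99 at most 0.335. *)
Let gain : (423 / 1000 * F2 - 247 / 1000 * (F3 / n)) / (2 * n) <=
  847 / 2000 * n / 2 * ((1 - eps) * \sum_u \sum_w e u w * (2 / (n * M u w)))
  - 3 * (1 + eps) * (\sum_u \sum_w e u w * (gam u w * far_deg u w)) / (6 * (299 / 100 / n)).
Proof.
rewrite [leLHS](_ : _ = \sum_u \sum_w e u w *
   ((423 / 1000 - 247 / 1000 * (far_deg u w / n)) / (2 * n))); last first.
  rewrite mulr_suml !mulr_sumr -sumrB mulr_suml; apply: eq_bigr => u _.
  rewrite mulr_suml !mulr_sumr -sumrB mulr_suml; apply: eq_bigr => w _; ring.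
rewrite !mulr_sumr mulr_suml -sumrB; apply: ler_sum => u _.
rewrite !mulr_sumr mulr_suml -sumrB; apply: ler_sum => w _.
set t := far_deg u w; have /andP[t0 tn] := far_deg_le u w; rewrite -/t in t0 tn.
have := pair_gain n_gt0 (M_ge u w) (M_le u w) t0 tn; set m := M u w.
have m0 : 0 < m by apply: M_gt0.
have -> : 847 / 2000 * n / 2 * ((1 - eps) * (e u w * (2 / (n * m)))) -
   3 * (1 + eps) * (e u w * (gam u w * t)) / (6 * (299 / 100 / n)) =
   e u w * (847 / 2000 * (1 - eps) / m - (1 + eps) * (100 / 299) * (t / m ^+ 2)).
  by rewrite /gam -/m; move: n_gt0; move: n => y y0; field; rewrite !gt_eqF.
move=> H; rewrite ler_wpM2l //; apply: le_trans H _; apply: lerB.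
  by rewrite ler_pM2r ?invr_gt0 //; move: eps0; lra.
have tm : 0 <= t / m ^+ 2 by apply: divr_ge0 => //; apply: exprn_ge0; exact: ltW.
by apply: ler_wpM2r => //; move: eps0; lra.
Qed.

Let numeric : 73 / 2000 * r%:R <= (423 / 1000 * F2 - 247 / 1000 * (F3 / n)) / (2 * n).
Proof.
have r0 : 0 < r%:R :> R by move: r_large; lra.
rewrite ler_pdivlMr ?mulr_gt0 //.
have /andP[Fl Fu] := F2_bounds.
have F20 : 0 <= F2 by do 2!(apply: sumr_ge0 => ? _).
pose phi := F2 / r%:R ^+ 2.
have FE : F2 = phi * r%:R ^+ 2 by rewrite /phi divfK // gt_eqF // exprn_gt0.
have p1 : phi <= 1 by rewrite /phi ler_pdivrMr ?exprn_gt0 // mul1r.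
have p2 : 249 / 1000 <= phi.
  rewrite /phi ler_pdivlMr ?exprn_gt0 //; apply: le_trans Fl.
  have := ler_wpM2l (ltW r0) r_large; rewrite -expr2; lra.
have F3n : F3 / n <= phi * (phi + 4^-1) * r%:R ^+ 2.
  apply: le_trans (_ : F3 / r%:R <= _).
    have F30 : 0 <= F3.
      apply: sumr_ge0 => a _; apply: sumr_ge0 => b _; apply: mulr_ge0 => //.
      by case/andP: (far_deg_le a b).
    by rewrite ler_wpM2l // lef_pV2 ?posrE // nr lerDl.
  rewrite ler_pdivrMr //; apply: le_trans F3_le _; rewrite FE.
  by rewrite le_eqVlt; apply/orP; left; apply/eqP; field; rewrite gt_eqF.
(* The quadratic is concave in [phi], so its minimum on [0.249, 1] is at an end; at 0.249 it is
   about 0.0746. *)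
have q : 74 / 1000 <= phi * (423 / 1000 - 247 / 1000 * (phi + 4^-1)).
  have : 0 <= (phi - 249 / 1000) * (1 - phi) by apply: mulr_ge0; lra.
  lra.
apply: le_trans (_ : 74 / 1000 * r%:R ^+ 2 <= _); last first.
  apply: le_trans (ler_wpM2r _ q) _; first by rewrite exprn_ge0.
  rewrite (_ : phi * _ * _ = 423 / 1000 * (phi * r%:R ^+ 2) -
    247 / 1000 * (phi * (phi + 4^-1) * r%:R ^+ 2)); last by ring.
  by rewrite -FE lerD2l lerN2; apply: ler_wpM2l => //; apply: divr_ge0.
rewrite nr; have := ler_wpM2l (ltW r0) r_large; rewrite -expr2; lra.
Qed.

Lemma expected_saving_ge (c K : nat) :
  965 / 1000 * r%:R - 1 <= c%:R :> R -> c%:R <= r%:R :> R -> 100 * 100 <= K%:R :> R ->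
  36 / 1000 * r%:R <= avg (fun w : {ffun 'I_c -> X} => truncated_saving R K nbr_locals w).
Proof.
move=> c_ge c_le K_large.
have r0 : 0 < r%:R :> R by move: r_large; lra.
have n1 : 100 * 100 <= n by rewrite nr; move: r_large; lra.
have KK : 100 * 100 * (99 * 100) <= K%:R * (K%:R - 1) :> R.
  by apply: ler_pM; move: K_large; lra.
have y0 : 0 < 299 / 100 / n by rewrite !divr_gt0.
have K1 : (1 < K)%N by rewrite -(ltr_nat R); move: K_large; lra.
have p2 : 2 * n^-1 <= 1 by rewrite ler_pdivrMr // mul1r; move: n1; lra.
have T2P u w : u != w -> incl [set u; w] <= 3 / n ^+ 2.
  move=> uw; apply: le_trans (incl2_le uw) _.
  by rewrite ler_pM2r ?invr_gt0 ?exprn_gt0 //; move: eps0; lra.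
(* In units of 1/n: the single terms give 3 (1 - eps), truncation costs 0.003 and the pairs 0.001,
   leaving 2.993. *)
have yP u w z : 0 < incl [set u; w; z] -> 299 / 100 / n <=
   incl [set u] + incl [set w] + incl [set z] - 3 * (7 / n / (K%:R * (K%:R - 1))) - 3 * (3 / n ^+ 2).
  move=> i0; have inN a : a \in [set u; w; z] -> a \in N v.
    by move=> aB; apply: contraTT i0 => /(incl_out aB) ->; rewrite ltxx.
  have iu : (1 - eps) / n <= incl [set u] by apply: incl1_ge; apply: inN; rewrite !inE eqxx.
  have iw : (1 - eps) / n <= incl [set w] by apply: incl1_ge; apply: inN; rewrite !inE eqxx orbT.
  have iz : (1 - eps) / n <= incl [set z] by apply: incl1_ge; apply: inN; rewrite !inE eqxx orbT.
  have t1 : 7 / n / (K%:R * (K%:R - 1)) <= (1 / 1000) / n.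
    rewrite mulrAC ler_pM2r ?invr_gt0 // ler_pdivrMr; [|apply: lt_le_trans KK]; last by lra.
    lra.
  have t2 : 3 / n ^+ 2 <= (1 / 3000) / n.
    rewrite expr2 invfM mulrA ler_pM2r ?invr_gt0 // ler_pdivrMr //; move: n1; lra.
  have t3 : (299 / 100) / n <= (3 * (1 - eps) - 4 / 1000) / n.
    by rewrite ler_pM2r ?invr_gt0 //; move: eps0; lra.
  move: iu iw iz t1 t2 t3; set i := n^-1; set j := 3 / n ^+ 2.
  by set k := 7 * i / _; clearbody i j k; lra.
have mu1P u : avg (fun x : X => (u \in nbr_locals x)%:R *
  ((#|nbr_locals x|%:R - 1) * (#|nbr_locals x|%:R - 2))) <= 7 / n.
  apply: le_trans (mu1_le u) _; rewrite ler_piMl ?divr_ge0 //.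
  by case: (u \in N v).
apply: le_trans (expected_truncated_saving c X0 K1 p2 incl1_le mu1P T2P y0 yP).
rewrite -/mu; set G := \sum_(a < c) _.
have G_ge : 847 / 2000 * n <= G by apply: geometric_sum_ge r_large nr c_ge.
have G_le : G <= n / 2.
  have : G <= (2 * n^-1)^-1.
    apply: geometric_sum_le; first by rewrite mulr_gt0 ?invr_gt0.
    by rewrite lexx andbT subr_ge0.
  by rewrite invfM invrK mulrC.
have S10 : 0 <= (1 - eps) * \sum_u \sum_w e u w * (2 / (n * M u w)).
  apply: mulr_ge0; first by move: eps0; lra.
  do 2!(apply: sumr_ge0 => ? _); apply: mulr_ge0 => //; apply: divr_ge0 => //.
  by apply: mulr_ge0; exact: ltW.
exact: (saving_arithmetic (le_trans numeric gain) S10 mom2_ge mu_le_gam mu_ge0 mu_le7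
  r_large nr c_le (ler0n R c) K_large G_ge G_le).
Qed.

End NeighbourhoodSaving.

(** * Colouring graphs with sparse neighbourhoods *)

Section Completion.
Variables (V : finType) (N : V -> {set V}) (r c : nat) (F : 'I_c -> {set V}).
Hypothesis NV : forall u, #|N u| = r.
Hypothesis N_irrefl : forall u, u \notin N u.
Hypothesis N_sym : forall u w, (u \in N w) = (w \in N u).
Hypothesis F_indep : forall a u w, u \in F a -> w \in F a -> w \notin N u.
Hypothesis F_saving : forall v, (r < c + saving (fun a => F a :&: N v))%N.

Lemma fresh_setI (D : {set V}) a : fresh (fun a => F a :&: D) a = fresh F a :&: D.
Proof.
rewrite /fresh; apply/setP => u; rewrite !inE -big_distrl /= !inE.
by case: (u \in D); rewrite ?andbT ?andbF.
Qed.

(** At an uncoloured [v] let [U] be the neighbours lying in some class. They show |U| minus the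
    saving many colours, and the other r - |U| neighbours at most one each, so fewer than [c]
    colours occur around [v]. Keeping the first colours fixed preserves this count through the
    induction. *)
Lemma greedy_completion k (f : {ffun V -> option 'I_c}) :
  (#|[set u | f u == None]| <= k)%N ->
  (forall u a, u \in fresh F a -> f u = Some a) ->
  (forall u w a, w \in N u -> f u = Some a -> f w != Some a) ->
  exists g : V -> 'I_c, forall u w, w \in N u -> g u != g w.
Proof.
elim: k f => [|k IH] f fk fF fP; last first.
  have [f0|[v]] := set_0Vmem [set u | f u == None]; first by apply: (IH f); rewrite ?f0 ?cards0.
  rewrite inE => /eqP fv.
  pose used := [set a : 'I_c | [exists w in N v, f w == Some a]].
  pose FN a := F a :&: N v.
  pose U := \bigcup_a FN a.
  have used_lt : (#|used| < c)%N.
    pose A := [set a | fresh FN a != set0].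
    pose S := [set a : 'I_c | [exists w in N v :\: U, f w == Some a]].
    have UN : U \subset N v by apply/bigcupsP => a _; apply: subsetIr.
    have SD : (#|S| <= #|N v :\: U|)%N.
      rewrite -(card_imset _ (@Some_inj _)); apply: leq_trans (leq_imset_card f _).
      apply: subset_leq_card; apply/subsetP => o /imsetP[a + ->].
      by rewrite inE => /exists_inP[w wD /eqP <-]; apply: imset_f.
    have US : used \subset A :|: S.
      apply/subsetP => a; rewrite inE => /exists_inP[w wN /eqP fw]; rewrite inE.
      have [wU|wU] := boolP (w \in U); last first.
        apply/orP; right; rewrite inE; apply/exists_inP; exists w; last exact/eqP.
        by rewrite inE wU.
      have [b _] := bigcupP wU; rewrite inE => /andP[wFb _].
      have [b' wb'] := ex_fresh wFb.
      have := fF _ _ wb'; rewrite fw => -[E]; apply/orP; left.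
      by rewrite inE; apply/set0Pn; exists w; rewrite fresh_setI inE wN andbT E.
    have cA : (\sum_a (fresh FN a != set0) = #|A|)%N.
      by rewrite -sum1_card [RHS]big_mkcond; apply: eq_bigr => a _; rewrite inE; case: eqP.
    have := savingE FN; rewrite cA -/U => E1.
    have := cardsID U (N v); rewrite (setIidPr UN) NV => E2.
    have := leq_trans (subset_leq_card US) (leq_card_setU A S).
    by have := F_saving v; rewrite -/FN; move: SD E1 E2; clear; lia.
  have [a au] : exists a, a \notin used.
    apply/existsP; rewrite -negb_forall; apply: contraTN used_lt => /forallP H.
    by rewrite -leqNgt -[c in (c <= _)%N]card_ord subset_leq_card //; apply/subsetP => b _.
  apply: (IH [ffun u => if u == v then Some a else f u]).
  - rewrite -ltnS; apply: leq_trans fk; apply: proper_card; apply/properP; split.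
      by apply/subsetP => u; rewrite !inE ffunE; have [->|] := eqVneq u v.
    by exists v; rewrite !inE ?fv // ffunE eqxx.
  - move=> u b ub; rewrite ffunE; case: eqP => [uv|_]; last exact: fF.
    by rewrite uv in ub; rewrite (fF _ _ ub) in fv.
  - move=> u w b wu; rewrite !ffunE.
    have nu x : x \in N v -> f x != Some a.
      move=> xN; apply: contraNneq au => fx; rewrite inE.
      by apply/exists_inP; exists x => //; apply/eqP.
    have [uv|uv] := eqVneq u v; have [wv|wv] := eqVneq w v.
    + by move: wu; rewrite uv wv (negPf (N_irrefl v)).
    + by move=> [<-]; apply: nu; rewrite -uv.
    + by move=> fu; rewrite eq_sym -fu; apply: nu; rewrite N_sym -wv.
    + exact: fP.
have fS u : f u != None.
  by move: fk; rewrite leqn0 cards_eq0 => /eqP/setP/(_ u); rewrite !inE => ->.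
have gS u : {a | f u = Some a} by move: (fS u); case: (f u) => // a _; exists a.
exists (fun u => sval (gS u)) => u w wu.
have := svalP (gS u); have := svalP (gS w).
by move=> fw /(fP _ _ _ wu); apply: contraNneq => ->; apply/eqP.
Qed.

Lemma saving_completion : exists g : V -> 'I_c, forall u w, w \in N u -> g u != g w.
Proof.
apply: (@greedy_completion _ [ffun u => [pick a | u \in fresh F a]] (leqnn _)).
  move=> u a ua; rewrite ffunE; case: pickP => [b ub|/(_ a)]; last by rewrite ua.
  by rewrite (fresh_inj ua ub).
move=> u w a wu; rewrite !ffunE.
case: pickP => // b ub [<-]; case: pickP => // b' wb'; apply: contraTneq wb' => -[->].
apply: contraL wu; rewrite inE => /andP[_ wb]; apply: F_indep wb.
by move: ub; rewrite inE => /andP[].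
Qed.

End Completion.

Section Regular.
Variable R : realType.

Lemma ex_labels (m : nat) (eps : R) : 0 < eps <= 1 -> exists L, (0 < L)%N /\
  forall k, (k <= m)%N -> 1 - eps <= (L.-2%:R / L%:R) ^+ k /\
     (L.+2%:R / L%:R) ^+ k <= 1 + eps.
Proof.
(* L - 2 >= b makes 2k/(L - 2) <= eps/4. Bernoulli's inequality then gives the lower bound directly
   and the upper one through (L + 2)/L = 1/(1 - 2/(L + 2)) and (1 + eps)(1 - eps/4) >= 1. *)
move=> /andP[e0 e1]; pose b : R := 8 * m%:R / eps.
have b0 : 0 <= b by rewrite divr_ge0 ?mulr_ge0 // ltW.
pose L := (Num.bound b).+3; exists L; split => // k km.
have bL : b <= L.-2%:R.
  apply: ltW; apply: lt_le_trans (archi_boundP b0) _; rewrite ler_nat; exact: leqnSn.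
have LE : L%:R = L.-2%:R + 2 :> R by rewrite -natrD addn2.
have l0 : 0 < L.-2%:R :> R by rewrite ltr0n.
have L0 : 0 < L%:R :> R by rewrite ltr0n.
have bern (z : R) j : 0 <= z <= 1 -> 1 - j%:R * z <= (1 - z) ^+ j.
  move=> /andP[z0 z1]; elim: j => [|j IH]; first by rewrite mul0r subr0 expr0.
  rewrite exprSr; apply: le_trans (_ : (1 - j%:R * z) * (1 - z) <= _); last first.
    by rewrite ler_wpM2r // subr_ge0.
  have : 0 <= j%:R * z * z by rewrite !mulr_ge0.
  by rewrite -natr1; lra.
have kz : k%:R * (2 / L.-2%:R) <= eps / 4.
  rewrite mulrA ler_pdivrMr //; apply: le_trans (_ : eps / 4 * b <= _); last first.
    by rewrite ler_wpM2l // divr_ge0 // ltW.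
  rewrite /b; have : k%:R <= m%:R :> R by rewrite ler_nat.
  have -> : eps / 4 * (8 * m%:R / eps) = m%:R * 2 by field; rewrite gt_eqF.
  by move=> ?; rewrite ler_pM2r.
have z1 : 2 / L%:R <= 2 / L.-2%:R :> R by rewrite ler_pM2l // lef_pV2 // LE lerDl.
have kz1 : k%:R * (2 / L%:R) <= eps / 4 by apply: le_trans kz; apply: ler_wpM2l.
have zz : 0 <= (2 / L%:R : R) <= 1.
  apply/andP; split; first exact: divr_ge0.
  by rewrite ler_pdivrMr // mul1r LE lerDr ltW.
split.
  have -> : L.-2%:R / L%:R = 1 - 2 / L%:R :> R.
    by rewrite LE; field; rewrite gt_eqF // ltr_wpDl // ltW.
  by apply: le_trans (bern _ k zz); lra.
have q0 : 0 < (1 - 2 / L.+2%:R) ^+ k :> R.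
  by apply: exprn_gt0; rewrite subr_gt0 ltr_pdivrMr // mul1r ltr_nat.
have -> : L.+2%:R / L%:R = (1 - 2 / L.+2%:R)^-1 :> R.
  have -> : L.+2%:R = L%:R + 2 :> R by rewrite -natrD addn2.
  have l2 : L%:R + 2 != 0 :> R by rewrite gt_eqF // addr_gt0.
  by rewrite -[X in X - _](divff l2) -mulrBl addrK invf_div.
rewrite exprVn -[leLHS]mul1r ler_pdivrMr //.
have z3 : 0 <= (2 / L.+2%:R : R) <= 1.
  apply/andP; split; first exact: divr_ge0.
  by rewrite ler_pdivrMr // mul1r ler_nat.
apply: le_trans (_ : (1 + eps) * (1 - k%:R * (2 / L.+2%:R)) <= _); last first.
  by rewrite ler_wpM2l ?bern // addr_ge0 // ltW.
have kz3 : k%:R * (2 / L.+2%:R) <= eps / 4.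
  apply: le_trans kz1; apply: ler_wpM2l => //.
  by rewrite ler_pM2l // lef_pV2 ?posrE ?ltr0n // ler_nat -addn2 leq_addr.
have : (1 + eps) * (1 - eps / 4) <= (1 + eps) * (1 - k%:R * (2 / L.+2%:R)).
  by rewrite ler_wpM2l ?lerD2l ?lerN2 // addr_ge0 // ltW.
apply: le_trans; have : eps * eps <= eps * 1 by rewrite ler_wpM2l // ltW.
lra.
Qed.

End Regular.

Lemma deviation_le_double (R : realFieldType) (x : R) : 1 <= x -> 1 / 2000 <= 2 * x.
Proof. lra. Qed.

(** A failing vertex saves at most r - c <= 0.035 r + 1, against at least 0.036 r expected; half of
    the gap r/1000 absorbs the 1 and the other half is the deviation. *)
Lemma few_savings_deviate (R : realFieldType) (c s r m : R) :
  100 * 100 <= r -> 965 / 1000 * r - 1 <= c -> 36 / 1000 * r <= m -> c + s <= r ->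
  s <= m - 1 / 2000 * r.
Proof. lra. Qed.

Lemma leq_card_bigcup (I T : finType) (P : pred I) (F : I -> {set T}) :
  (#|\bigcup_(i | P i) F i| <= \sum_(i | P i) #|F i|)%N.
Proof.
elim/big_rec2: _ => [|i n A _ IH]; first by rewrite cards0.
by apply: leq_trans (leq_card_setU _ _) _; rewrite leq_add2l.
Qed.

(** * Bad vertices and the local lemma *)

Section Assembly.
Variables (R : realType) (V : finType) (N : V -> {set V}) (r L c K : nat).
Hypothesis NV : forall u, #|N u| = r.
Hypothesis N_irrefl : forall u, u \notin N u.
Hypothesis N_sym : forall u w, (u \in N w) = (w \in N u).
Hypothesis L0 : (0 < L)%N.
Local Notation X := {ffun V -> 'I_L}.
Local Notation Omega := {ffun 'I_c -> X}.

(** The labels that decide which neighbours of [v] are local maxima, hence whether [v] is bad. *)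
Definition ball (v : V) : {set V} := \bigcup_(u in N v) (u |: N u).

Definition bad (v : V) (w : Omega) : bool :=
  (c + saving (fun a => nbr_locals N v (w a)) <= r)%N.

Lemma bad_determined v : determined_on (ball v) (bad v).
Proof.
move=> w w' ww'; rewrite /bad; congr (_ + _ <= _)%N.
rewrite /saving; apply: eq_bigr => a _; congr (#|_|.-1).
suff E b : nbr_locals N v (w b) = nbr_locals N v (w' b).
  by rewrite /fresh E; congr (_ :\: _); apply: eq_bigr => b _.
apply/setP => u; rewrite !inE; case: (boolP (u \in N v)) => uN; rewrite ?andbF ?andbT //.
have ub : u \in ball v by apply/bigcupP; exists u => //; rewrite setU11.
rewrite /local_max (ww' b u ub); apply: eq_forallb_in => z zN.
by rewrite (ww' b z) //; apply/bigcupP; exists u => //; rewrite inE zN orbT.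
Qed.

Lemma ballC u v : (u \in ball v) = (v \in ball u).
Proof.
suff H a b : a \in ball b -> b \in ball a by apply/idP/idP; apply: H.
move=> /bigcupP[x xb]; rewrite inE => /orP[/set1P ax|ax].
  by apply/bigcupP; exists b; rewrite ?setU11 // N_sym ax.
by apply/bigcupP; exists x; rewrite ?inE N_sym // xb orbT.
Qed.

Lemma card_ball v : (#|ball v| <= r * r.+1)%N.
Proof.
rewrite -[X in (_ <= X * _)%N](NV v) -sum_nat_const.
apply: leq_trans (leq_card_bigcup _ _) _; apply: leq_sum => u _.
by rewrite cardsU1 NV N_irrefl.
Qed.

Lemma card_dependent v :
  (#|[set u | ~~ [disjoint ball u & ball v]]| <= (r * r.+1) ^ 2)%N.
Proof.
apply: (@leq_trans #|\bigcup_(z in ball v) ball z|).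
  apply: subset_leq_card; apply/subsetP => u; rewrite inE => /pred0Pn[z /andP[/= zu zv]].
  by apply/bigcupP; exists z; rewrite // ballC.
apply: (leq_trans (leq_card_bigcup _ _)).
apply: leq_trans (_ : \sum_(z in ball v) (r * r.+1) <= _)%N.
  by apply: leq_sum => z _; apply: card_ball.
by rewrite sum_nat_const expnS expn1 leq_mul2r card_ball orbT.
Qed.

Hypothesis labels : forall k, (k <= 2 * r + 4)%N ->
  1 - 1 / 1000 <= (L.-2%:R / L%:R) ^+ k :> R /\ (L.+2%:R / L%:R) ^+ k <= 1 + 1 / 1000 :> R.
Hypothesis sparse : forall v,
  \sum_(u in N v) \sum_(w in N v) ((u == w) || (w \in N u))%:R <=
  3 / 4 * r%:R ^+ 2 + r%:R :> R.
Hypothesis r_large : 100 * 100 <= r%:R :> R.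
Hypothesis c_ge : 965 / 1000 * r%:R - 1 <= c%:R :> R.
Hypothesis c_le : c%:R <= r%:R :> R.
Hypothesis K_large : 100 * 100 <= K%:R :> R.

Let D : R := (4 * K + 1)%:R.
Let kappa : R := (1 / 2000) ^+ 2 / (8 * D ^+ 2).

Let X0 : (0 < #|X|)%N. Proof. by rewrite card_ffun card_ord expn_gt0 L0. Qed.

Lemma avg_bad v : avg (fun w : Omega => (bad v w)%:R) <= expR (- (kappa * r%:R)).
Proof.
pose f (w : Omega) := truncated_saving R K (nbr_locals N v) w.
have Ef : 36 / 1000 * r%:R <= avg f.
  apply: (@expected_saving_ge R V N r L NV N_irrefl N_sym L0 (1 / 1000)) => //.
  - by move=> k /labels[].
  - by move=> k /labels[].
  - by rewrite divr_gt0 //= lexx.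
have D0 : 0 < D by rewrite ltr0n addn1.
have D1 : 1 <= D by rewrite ler1n addn1.
have fD : lipschitz D f by move=> w i x; apply: lipschitz_truncated_saving.
have cr : #|'I_c|%:R <= r%:R :> R by rewrite card_ord.
have e1 : 1 / 2000 <= 2 * D :> R by exact: deviation_le_double.
have e0 : 0 < 1 / 2000 :> R by rewrite divr_gt0.
have -> : kappa * r%:R = (1 / 2000) ^+ 2 * r%:R / (8 * D ^+ 2) by rewrite /kappa mulrAC.
apply: le_trans (lower_tail_lipschitz X0 D0 e0 e1 cr fD).
apply: ler_avg => w; rewrite ler_nat; case: (boolP (bad v w)) => // bw.
suff -> : f w <= avg f - 1 / 2000 * r%:R by [].
apply: le_trans (truncated_saving_le _ _ _ _) _.
by apply: few_savings_deviate r_large c_ge Ef _; rewrite -natrD ler_nat.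
Qed.

Lemma regular_coloring : 4 * expR (- (kappa * r%:R)) * ((r * r.+1) ^ 2)%:R <= 1 ->
  exists g : V -> 'I_c, forall u w, w \in N u -> g u != g w.
Proof.
move=> lll.
have r0 : (0 < r)%N by rewrite -(ltr_nat R); apply: lt_le_trans r_large; rewrite mulr_gt0.
have lll1 : 4 * expR (- (kappa * r%:R)) <= 1.
  apply: le_trans lll; rewrite ler_peMr ?mulr_ge0 ?expR_ge0 //.
  by rewrite ler1n expn_gt0 muln_gt0 r0.
have O0 : (0 < #|Omega|)%N by rewrite card_ffun expn_gt0 X0.
have [w good] := local_lemma_product O0 (expR_ge0 _) avg_bad bad_determined
  card_dependent lll lll1.
apply: (@saving_completion V N r c (fun a => locals N (w a))) => //.
  by move=> a; apply: (locals_indep N_sym).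
by move=> v; have := good v; rewrite /bad -ltnNge.
Qed.

End Assembly.

Lemma expR_beats_degree (R : realType) (kappa : R) : 0 < kappa ->
  exists r0, forall r, (r0 <= r)%N ->
    4 * expR (- (kappa * r%:R)) * ((r * r.+1) ^ 2)%:R <= 1 :> R.
Proof.
(* The dependency degree is of order r^4, so exp(x) >= (x/5)^5 suffices; r >= b gives (kappa r/5)^5
   >= 16 r^4. *)
move=> k0; pose b : R := 16 * (5 / kappa) ^+ 5.
have b0 : 0 <= b by rewrite mulr_ge0 // exprn_ge0 // divr_ge0 // ltW.
exists (Num.bound b).+1 => r rb.
have r0 : (0 < r)%N by apply: leq_trans rb.
have br : b <= r%:R.
  by apply: ltW; apply: lt_le_trans (archi_boundP b0) _; rewrite ler_nat ltnW.
set x := kappa * r%:R.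
have x0 : 0 <= x by rewrite mulr_ge0 // ltW.
have H1 : (x / 5) ^+ 5 <= expR x.
  have {2}-> : x = 5%:R * (x / 5) by rewrite mulrCA divff ?mulr1 ?pnatr_eq0.
  rewrite expRM_natl lerXn2r ?nnegrE ?expR_ge0 ?divr_ge0 //.
  by apply: le_trans (expR_ge1Dx _); rewrite lerDr.
have H2 : ((r * r.+1) ^ 2)%:R <= 4 * r%:R ^+ 4 :> R.
  rewrite -natrX -natrM ler_nat; apply: (@leq_trans ((r * (2 * r)) ^ 2)).
    by rewrite leq_exp2r // leq_mul2l mul2n -addnn -addn1 leq_add2l r0 orbT.
  by rewrite leq_eqVlt; apply/orP; left; apply/eqP; ring.
rewrite expRN mulrAC ler_pdivrMr ?expR_gt0 // mul1r; apply: le_trans H1.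
apply: le_trans (_ : 4 * (4 * r%:R ^+ 4) <= _); first by rewrite ler_pM2l.
have -> : (x / 5) ^+ 5 = (kappa / 5) ^+ 5 * r%:R * r%:R ^+ 4 by rewrite /x; ring.
have -> : 4 * (4 * r%:R ^+ 4) = 16 * r%:R ^+ 4 :> R by ring.
apply: ler_wpM2r; first by rewrite exprn_ge0.
have c0 : 0 < (kappa / 5) ^+ 5 by rewrite exprn_gt0 // divr_gt0.
rewrite mulrC -ler_pdivrMr //; apply: le_trans br.
by rewrite /b -exprVn invf_div.
Qed.

(** [K], and with it the exponential rate, is fixed before [r], and [L] after it. This order is
    possible because the tail bound involves neither [L] nor the number of vertices. *)
Lemma regular_coloring_large (R : realType) : exists r0, forall r, (r0 <= r)%N ->
  forall (V : finType) (N : V -> {set V}) (c : nat),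
  (forall u, #|N u| = r) -> (forall u, u \notin N u) ->
  (forall u w, (u \in N w) = (w \in N u)) ->
  (forall v, \sum_(u in N v) \sum_(w in N v) ((u == w) || (w \in N u))%:R <=
    3 / 4 * r%:R ^+ 2 + r%:R :> R) ->
  965 / 1000 * r%:R - 1 <= c%:R :> R -> (c <= r)%N ->
  exists g : V -> 'I_c, forall u w, w \in N u -> g u != g w.
Proof.
have large : 0 <= 100 * 100 :> R by rewrite mulr_ge0.
pose K := Num.bound (100 * 100 : R).
have K_large : 100 * 100 <= K%:R :> R by apply/ltW/archi_boundP/large.
have k0 : 0 < (1 / 2000) ^+ 2 / (8 * (4 * K + 1)%:R ^+ 2) :> R.
  apply: divr_gt0; first by rewrite exprn_gt0 // divr_gt0.
  by rewrite mulr_gt0 // exprn_gt0 // ltr0n addn1.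
have [r0 r0P] := expR_beats_degree k0.
exists (maxn r0 K) => r; rewrite geq_max => /andP[rr0 rK] V N c NV Ni Ns sparse c_ge c_le.
have eps01 : 0 < (1 / 1000 : R) <= 1.
  by apply/andP; split; [apply: divr_gt0|rewrite ler_pdivrMr // mul1r ler1n].
have [L [L0 labels]] := ex_labels (2 * r + 4) eps01.
apply: (regular_coloring NV Ni Ns L0 (K := K) labels sparse) => //.
- by apply: le_trans K_large _; rewrite ler_nat.
- by rewrite ler_nat.
exact: r0P.
Qed.

(** * Embedding into a regular graph *)

Section Regularization.
Variables (V : finType) (e : rel V) (r : nat).
Hypothesis e_sym : symmetric e.
Hypothesis e_irrefl : irreflexive e.
Let Nb v := [set w | e v w].
Hypothesis deg_le : forall v, (#|Nb v| <= r)%N.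

Definition flip (X : {set 'I_r}) (i : 'I_r) : {set 'I_r} :=
  [set j | (j \in X) (+) (j == i)].

Lemma flipK X i : flip (flip X i) i = X.
Proof. by apply/setP => j; rewrite !inE -addbA addbb addbF. Qed.

Lemma flip_inj X : injective (flip X).
Proof.
move=> i j /setP/(_ i); rewrite !inE eqxx.
by case: (i \in X) => /=; case: eqP.
Qed.

Lemma odd_flip X i : odd #|flip X i| = ~~ odd #|X|.
Proof.
have -> : flip X i = if i \in X then X :\ i else i |: X.
  by apply/setP => j; rewrite inE; case: ifP => iX; rewrite !inE;
    have [->|ji] := eqVneq j i; rewrite ?iX //= ?addbF ?andbT.
by case: ifP => iX; [rewrite [in RHS](cardsD1 i) iX negbK|rewrite cardsU1 iX].
Qed.

Let slots v := [set i : 'I_r | (i < r - #|Nb v|)%N].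

(* The copies of [v] form a hypercube of dimension [r - deg v], so every vertex gets degree [r];
   hypercubes are bipartite, so no new edge appears inside a neighbourhood. *)
Definition regular_nbr (p : V * {set 'I_r}) : {set V * {set 'I_r}} :=
  [set (w, p.2) | w in Nb p.1] :|: [set (p.1, flip p.2 i) | i in slots p.1].

Let mem_nbr p q : (q \in regular_nbr p) =
  ((q.2 == p.2) && e p.1 q.1) || ((q.1 == p.1) && [exists i in slots p.1, q.2 == flip p.2 i]).
Proof.
case: p q => v X [w Y]; rewrite inE /=; congr (_ || _).
  apply/imsetP/andP => [[w' + [-> ->]]|[/eqP -> vw]]; first by rewrite inE.
  by exists w; rewrite ?inE.
apply/imsetP/andP => [[i si [-> ->]]|[/eqP -> /exists_inP[i si /eqP ->]]]; last by exists i.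
by split => //; apply/exists_inP; exists i.
Qed.

Lemma regular_nbr_irrefl p : p \notin regular_nbr p.
Proof.
rewrite mem_nbr e_irrefl andbF eqxx /=; apply/exists_inP => -[i _ /eqP H].
by have := odd_flip p.2 i; rewrite -H; case: odd.
Qed.

Lemma regular_nbr_sym p q : (p \in regular_nbr q) = (q \in regular_nbr p).
Proof.
rewrite !mem_nbr eq_sym e_sym; congr (_ || _).
have [->|] := eqVneq p.1 q.1; last by [].
by apply: eq_existsb => i; congr (_ && _); apply/eqP/eqP => ->; rewrite flipK.
Qed.

Let pair_inj (X : {set 'I_r}) : injective (fun w : V => (w, X)).
Proof. by move=> a b []. Qed.

Let flip_pair_inj (p : V * {set 'I_r}) : injective (fun i => (p.1, flip p.2 i)).
Proof. by move=> a b [] /flip_inj. Qed.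

Let parts_disjoint p :
  [disjoint [set (w, p.2) | w in Nb p.1] & [set (p.1, flip p.2 i) | i in slots p.1]].
Proof.
rewrite -setI_eq0; apply/eqP/setP => q; rewrite in_set0 in_setI; apply/negP.
move=> /andP[/imsetP[w + ->] /imsetP[i _ [wp _]]].
by rewrite inE wp e_irrefl.
Qed.

Let card_slots v : #|slots v| = (r - #|Nb v|)%N.
Proof.
rewrite -sum1_card (eq_bigl (fun i : 'I_r => (i < r - #|Nb v|)%N)); last by move=> i; rewrite inE.
by rewrite -(big_ord_widen r (fun=> 1%N) (leq_subr _ _)) big_const_ord iter_addn mul1n addn0.
Qed.

Lemma card_regular_nbr p : #|regular_nbr p| = r.
Proof.
rewrite cardsU disjoint_setI0 // cards0 subn0.
by rewrite (card_imset _ (@pair_inj p.2)) (card_imset _ (@flip_pair_inj p)) card_slots subnKC.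
Qed.

Let sum_nbr (R : realFieldType) p (f : V * {set 'I_r} -> R) :
  \sum_(q in regular_nbr p) f q =
  \sum_(w in Nb p.1) f (w, p.2) + \sum_(i in slots p.1) f (p.1, flip p.2 i).
Proof.
rewrite /regular_nbr (eq_bigl _ _ (fun q => in_setU q _ _)) bigU //=.
rewrite (big_imset _ (in2W (@pair_inj p.2))).
by rewrite (big_imset _ (in2W (@flip_pair_inj p))).
Qed.

(** Two flips of one set have equal parity, and a copy of a neighbour differs from a cube neighbour
    in both coordinates; so cube neighbours add only their diagonal terms, at most [r]. *)
Lemma sparse_regular_nbr (R : realFieldType) (s : R) p :
  \sum_(u in Nb p.1) \sum_(w in Nb p.1) ((u == w) || e u w)%:R <= s ->
  \sum_(u in regular_nbr p) \sum_(w in regular_nbr p)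
    ((u == w) || (w \in regular_nbr u))%:R <= s + r%:R.
Proof.
move=> sp; rewrite sum_nbr; apply: lerD.
  apply: le_trans sp; apply: ler_sum => u uN; rewrite inE in uN.
  rewrite sum_nbr [X in _ + X]big1 ?addr0; last first.
    move=> i _; rewrite mem_nbr /= xpair_eqE.
    have uv : u != p.1 by apply: contraTneq uN => ->; rewrite e_irrefl.
    rewrite (negPf uv) [p.1 == u]eq_sym (negPf uv) /= orbF.
    case: eqP => // H; have := odd_flip p.2 i; rewrite H; by case: odd.
  apply: ler_sum => w _; rewrite ler_nat.
  have [->|uw] := eqVneq u w; first exact: leq_b1.
  by rewrite mem_nbr /= xpair_eqE [w == u]eq_sym (negPf uw) eqxx /= orbF.
apply: le_trans (_ : \sum_(i in slots p.1) 1 <= _); last first.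
  by rewrite sumr_const card_slots ler_nat leq_subr.
apply: ler_sum => i _; rewrite sum_nbr [X in X + _]big1 ?add0r; last first.
  move=> w; rewrite inE => wN; rewrite mem_nbr /= xpair_eqE.
  have wv : w != p.1 by apply: contraTneq wN => ->; rewrite e_irrefl.
  rewrite [p.1 == w]eq_sym (negPf wv) /= orbF; case: eqP => // H.
  by have := odd_flip p.2 i; rewrite -H; case: odd.
rewrite (eq_bigr (fun j => (i == j)%:R)); last first.
  move=> j _; rewrite mem_nbr /= xpair_eqE eqxx /= (inj_eq (@flip_inj _)) e_irrefl andbF /=.
  rewrite [X in _ || X](_ : _ = false) ?orbF //; apply/exists_inP => -[k _ /eqP H].
  by have := odd_flip (flip p.2 i) k; rewrite -H !odd_flip; case: odd.
rewrite -natr_sum lern1; apply: (@leq_trans (\sum_j (i == j))).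
  by rewrite big_mkcond; apply: leq_sum => j _; case: ifP.
by rewrite (bigD1 i) //= eqxx big1 // => j; rewrite eq_sym => /negPf ->.
Qed.
End Regularization.

Lemma sparse_coloring (R : realType) : exists r0, forall r, (r0 <= r)%N ->
  forall (V : finType) (e : rel V) (c : nat), symmetric e -> irreflexive e ->
  (forall v, #|[set w | e v w]| <= r)%N ->
  (forall v, \sum_(u in [set w | e v w]) \sum_(w in [set w | e v w])
    ((u == w) || e u w)%:R <= 3 / 4 * r%:R ^+ 2 :> R) ->
  965 / 1000 * r%:R - 1 <= c%:R :> R -> (c <= r)%N ->
  exists g : V -> 'I_c, forall u w, e u w -> g u != g w.
Proof.
have [r0 H] := regular_coloring_large R; exists r0 => r rr0 V e c e_sym e_irr deg sp c_ge c_le.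
have [g gP] := H r rr0 _ (@regular_nbr V e r) c (card_regular_nbr e_irr deg)
  (regular_nbr_irrefl e_irr) (regular_nbr_sym e_sym)
  (fun p => sparse_regular_nbr e_irr (sp p.1)) c_ge c_le.
exists (fun v => g (v, set0)) => u w uw; apply: gP.
by apply/setUP; left; apply/imsetP; exists w; rewrite ?inE.
Qed.

(** * Strong edge colourings *)

Section SquareOfLineGraph.
Variable G : sgraph.
Local Notation D := (max_degree G).

Definition edge := {A : {set G} | A \in edges G}.

Definition conflict (f g : edge) := (f != g) && linked (val f) (val g).

Definition edge_nbr (f : {set G}) : {set G} := [set z | [exists x in f, adj x z]].

Lemma linkedC (f g : {set G}) : linked f g = linked g f :> bool.
Proof.
suff H (a b : {set G}) : linked a b -> linked b a by apply/idP/idP; apply: H.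
move=> /exists_inP[x xa /exists_inP[y yb xy]]; apply/exists_inP; exists y => //.
by apply/exists_inP; exists x; rewrite // adj_sym.
Qed.

Lemma edgeP (A : {set G}) : A \in edges G -> exists x y, adj x y /\ A = [set x; y].
Proof. by move=> /imsetP[[x y]]; rewrite inE => xy ->; exists x, y. Qed.

Lemma edge_mate (A : {set G}) x : A \in edges G -> x \in A ->
  exists2 y, y \in A & adj x y.
Proof.
move=> /edgeP[a [b [ab ->]]]; rewrite !inE => /orP[]/eqP->.
  by exists b; rewrite // !inE eqxx orbT.
by exists a; rewrite ?inE ?eqxx // adj_sym.
Qed.

Lemma linked_meet (A B : {set G}) z : A \in edges G -> z \in A -> z \in B -> linked A B.
Proof.
move=> AE zA zB; have [y yA zy] := edge_mate AE zA.
by apply/exists_inP; exists y => //; apply/exists_inP; exists z; rewrite // adj_sym.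
Qed.

Lemma linked_refl (A : {set G}) : A \in edges G -> linked A A.
Proof.
by move=> AE; have [x [y [xy E]]] := edgeP AE; apply: (@linked_meet _ _ x); rewrite // E !inE eqxx.
Qed.

Lemma linked_edges_at (f g : {set G}) : g \in edges G -> linked f g -> g \in edges_at (edge_nbr f).
Proof.
move=> gE /exists_inP[x xf /exists_inP[y yg xy]]; rewrite inE gE /=.
rewrite -setI_eq0; apply/set0Pn; exists y; rewrite !inE yg /=.
by apply/exists_inP; exists x.
Qed.

Lemma card_edge_nbr f : f \in edges G -> (#|edge_nbr f| <= 2 * D)%N.
Proof.
move=> /edgeP[x [y [_ ->]]].
apply: (@leq_trans #|[set z | adj x z] :|: [set z | adj y z]|).
  apply: subset_leq_card; apply/subsetP => z; rewrite !inE => /exists_inP[w].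
  by rewrite !inE => /orP[]/eqP-> ->; rewrite ?orbT.
by apply: leq_trans (leq_card_setU _ _) _; rewrite mul2n -addnn leq_add ?degree_le.
Qed.

Lemma card_edges_at (A : {set G}) : (#|edges_at A| <= #|A| * D)%N.
Proof.
apply: (@leq_trans #|\bigcup_(a in A) [set [set a; b] | b in [set b | adj a b]]|).
  apply: subset_leq_card; apply/subsetP => f; rewrite inE => /andP[fE].
  rewrite -setI_eq0 => /set0Pn[a]; rewrite inE => /andP[af aA].
  apply/bigcupP; exists a => //; apply/imsetP.
  have [x [y [xy fxy]]] := edgeP fE; move: af; rewrite fxy !inE => /orP[]/eqP ->.
    by exists y; rewrite ?inE.
  by exists x; rewrite ?inE 1?adj_sym // setUC.
apply: leq_trans (leq_card_bigcup _ _) _; rewrite -sum_nat_const; apply: leq_sum => a _.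
by apply: leq_trans (leq_imset_card _ _) _; apply: degree_le.
Qed.

Lemma conflict_sym : symmetric conflict.
Proof. by move=> f g; rewrite /conflict eq_sym linkedC. Qed.

Lemma conflict_irrefl : irreflexive conflict.
Proof. by move=> f; rewrite /conflict eqxx. Qed.

Lemma card_conflict f : (#|[set g | conflict f g]| <= 2 * D ^ 2)%N.
Proof.
rewrite -(card_imset _ val_inj) expnS expn1 mulnA.
apply: leq_trans (_ : #|edges_at (edge_nbr (val f))| <= _)%N.
  apply: subset_leq_card; apply/subsetP => _ /imsetP[g + ->].
  by rewrite inE => /andP[_]; apply: linked_edges_at; apply: valP.
apply: leq_trans (card_edges_at _) _; rewrite leq_mul2r card_edge_nbr ?orbT //.
exact: valP.
Qed.

(** 3 D^4 is 3/4 of (2 D^2)^2. The diagonal costs nothing extra: an edge is linked to itself, so it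
    is already among the linked pairs counted. *)
Lemma conflict_sparse (R : realFieldType) f :
  \sum_(u in [set g | conflict f g]) \sum_(w in [set g | conflict f g])
    ((u == w) || conflict u w)%:R <= 3 / 4 * ((2 * D ^ 2)%N%:R) ^+ 2 :> R.
Proof.
have -> : 3 / 4 * ((2 * D ^ 2)%N%:R) ^+ 2 = 3 * D%:R ^+ 4 :> R.
  by rewrite natrM natrX; field.
apply: le_trans (card_linked_edges_at R (card_edge_nbr (valP f))).
pose Q := [set p : edge * edge | [&& conflict f p.1, conflict f p.2 & linked (val p.1) (val p.2)]].
rewrite pair_big_dep /=; apply: le_trans (_ : #|Q|%:R <= _).
  rewrite -sum1_card natr_sum big_mkcond [leRHS]big_mkcond; apply: ler_sum => -[u w] _ /=.
  rewrite !inE /=; case: (conflict f u); case: (conflict f w) => //=.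
  have [->|uw] := eqVneq u w; first by rewrite linked_refl //; apply: valP.
  by rewrite /conflict uw /=; case: linked.
have vi : injective (fun p : edge * edge => (val p.1, val p.2)).
  by move=> [a b] [a' b'] [/val_inj -> /val_inj ->].
rewrite -(card_imset _ vi) ler_nat; apply: subset_leq_card; apply/subsetP.
move=> _ /imsetP[[u w] + ->]; rewrite !inE /= => /and3P[/andP[_ fu] /andP[_ fw] uw].
have := linked_edges_at (valP u) fu; have := linked_edges_at (valP w) fw.
by rewrite !inE => -> ->.
Qed.

Lemma strong_chromatic_index_le c (g : edge -> 'I_c) :
  (forall u w, conflict u w -> g u != g w) -> (strong_chromatic_index G <= c)%N.
Proof.
(* [insub] extends the colouring of edges to all vertex sets, as [preim_partition] requires; on
   edges the value is a genuine colour. *)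
move=> gP; pose h (A : {set G}) : option 'I_c := omap g (insub A).
have hE A (AE : A \in edges G) : h A = Some (g (Sub A AE)) by rewrite /h insubT.
pose P := preim_partition h (edges G).
rewrite /strong_chromatic_index; case: ex_minnP => m _ /(_ #|P|) mP.
apply: leq_trans (mP _) _.
  apply/existsP; exists P; rewrite eqxx andbT; apply/andP; split; first exact: preim_partitionP.
  apply/forall_inP => M /imsetP[A0 _ ->]; apply/andP; split.
    by apply/subsetP => A; rewrite inE => /andP[].
  apply/forall_inP => A; rewrite !inE => /andP[AE /eqP hA].
  apply/forall_inP => B; rewrite !inE => /andP[BE /eqP hB].
  apply/implyP => nAB; have nl : ~~ linked A B.
    have := gP (Sub A AE) (Sub B BE).
    rewrite /conflict -val_eqE /= nAB /= => Hg; apply/negP => /Hg /eqP; apply.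
    by move: hA hB; rewrite (hE _ AE) (hE _ BE) => -> -[].
  apply/andP; split.
    rewrite -setI_eq0; apply: contraNT nl => /set0Pn[z]; rewrite inE => /andP[zA zB].
    exact: linked_meet zA zB.
  apply/forall_inP => x xA; apply/forall_inP => y yB; apply: contra nl => xy.
  by apply/exists_inP; exists x => //; apply/exists_inP; exists y.
apply: (@leq_trans #|[set [set A in edges G | Some a == h A] | a : 'I_c]|).
  apply: subset_leq_card; apply/subsetP => M /imsetP[A AE ->].
  by apply/imsetP; exists (g (Sub A AE)) => //; rewrite hE.
by apply: leq_trans (leq_imset_card _ _) _; rewrite card_ord.
Qed.

End SquareOfLineGraph.

Lemma color_count_ge (R : realFieldType) (d c : nat) : (193 * d <= c.+1 * 100)%N ->
  965 / 1000 * (2 * d)%N%:R - 1 <= c%:R :> R.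
Proof. by rewrite -(ler_nat R) !natrM -natr1; lra. Qed.

Lemma color_count_le (R : realFieldType) (d c : nat) : (c * 100 <= 193 * d ^ 2)%N ->
  c%:R <= 193 / 100 * d%:R ^+ 2 :> R.
Proof. by rewrite -(ler_nat R) !natrM expr2; lra. Qed.

From mathcomp Require Import Rstruct.

Theorem theorem1 :
  exists Delta0 : nat, forall G : sgraph, (Delta0 <= max_degree G)%N ->
    (strong_chromatic_index G)%:R <= 193 / 100 * (max_degree G)%:R ^+ 2 :> rat.
Proof.
(* The real exponential is needed only to find the colouring; the number [c] carries the bound back
   to the rationals. As D <= 2 D^2, the threshold for r = 2 D^2 also serves for [D]. *)
have [r0 H] := sparse_coloring Rdefinitions.RbaseSymbolsImpl.R.
exists r0 => G; set D := max_degree G => Dr0.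
(* 1.93 D^2 is 0.965 r for r = 2 D^2; rounding down accounts for the [- 1] in the hypothesis on
   [c]. *)
pose c := ((193 * D ^ 2) %/ 100)%N.
have rr0 : (r0 <= 2 * D ^ 2)%N.
  by apply: leq_trans Dr0 _; clear; nia.
have c_le : (c * 100 <= 193 * D ^ 2)%N by apply: leq_trunc_div.
have c_gt : (193 * D ^ 2 <= c.+1 * 100)%N by apply/ltnW/ltn_ceil.
have c2 : (c <= 2 * D ^ 2)%N by move: c_le; clear; lia.
have [|g gP] := H _ rr0 _ _ c (@conflict_sym G) (@conflict_irrefl G) (@card_conflict G)
   (@conflict_sparse G _) _ c2.
  exact: color_count_ge.
have := strong_chromatic_index_le gP; rewrite -(ler_nat rat) => /le_trans; apply.
exact: color_count_le.
Qed.
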